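(* Let $\ell\geq5$ be a prime and let $J/\mathbb{Q}$ be the Jacobian of a curve of genus $g$ over $\mathbb{Q}$. If the $G_{\mathbb{Q}}$-action on $J[\ell]$ is irreducible, quasi-unramified, and some element of $G_{\mathbb{Q}}$ acts on $J[\ell]$ as a transvection, then $\mathrm{Gal}(\mathbb{Q}(J[\ell])/\mathbb{Q})\cong\mathrm{GSp}_{2g}(\mathbb{F}_\ell)$. The same holds for $\ell=3$ provided that in addition $J[3]$ is absolutely irreducible and strongly quasi-unramified.
   Context: $J[\ell]$ is a symplectic $\mathbb{F}_\ell$-representation of $G_{\mathbb{Q}}$ via the Weil pairing. A $G_{\mathbb{Q}}$-stable decomposition of a symplectic space $V$ into symplectic subspaces is $V=\bigoplus_{i=1}^kV_i$ with the pairing non-degenerate on each $V_i$ and every $\sigma\in G_{\mathbb{Q}}$ permuting $\{V_1,\dots,V_k\}$. A symplectic $\mathbb{F}_\ell$-representation $V$ of $G_{\mathbb{Q}}$ is quasi-unramified if for every $G_{\mathbb{Q}}$-stable decomposition of $V$ into symplectic $\mathbb{F}_\ell$-subspaces, the permutation action of $G_{\mathbb{Q}}$ on $\{V_1,\dots,V_k\}$ is unramified at every prime (every inertia group acts trivially); it is strongly quasi-unramified if the same holds for all such decompositions of $V\otimes_{\mathbb{F}_\ell}\overline{\mathbb{F}}_\ell$ into symplectic $\overline{\mathbb{F}}_\ell$-subspaces. A transvection is a unipotent $\sigma$ with $\sigma-\mathrm{Id}$ of rank $1$. The isomorphism means the image of $G_{\mathbb{Q}}$ in $\mathrm{GSp}(J[\ell])\cong\mathrm{GSp}_{2g}(\mathbb{F}_\ell)$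 is everything. *)

(* Defs.v *)
From HB Require Import structures.
From mathcomp Require Import all_boot all_order all_algebra all_field.
From mathcomp Require Import boolp.
From mathcomp Require Import freeg.

Set Implicit Arguments.
Unset Strict Implicit.
Unset Printing Implicit Defensive.

Import Order.TTheory GRing.Theory Num.Theory.
Local Open Scope ring_scope.

(* algC serves as the algebraic closure of Q. Its ring endomorphisms are      *)
(* bijective and fix Q, so they are exactly the elements of G_Q.              *)
Definition GQ := {rmorphism algC -> algC}.

(* The nonzero primes of the ring Aint of all algebraic integers, above p.    *)
Record prime_above (p : nat) (P : algC -> Prop) : Prop := PrimeAbove {
  prime_above_Aint : forall x, P x -> x \in Aint;
  prime_above_p : P p%:R;
  prime_aboveD : forall x y, P x -> P y -> P (x + y);
  prime_aboveM : forall a x, a \in Aint -> P x -> P (a * x);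
  prime_above_proper : ~ P 1;
  prime_above_prime : forall x y,
    x \in Aint -> y \in Aint -> P (x * y) -> P x \/ P y
}.

(* The congruence forces s to map P onto P, so the decomposition group need   *)
(* not be mentioned.                                                          *)
Definition inertia (P : algC -> Prop) (s : GQ) : Prop :=
  forall x, x \in Aint -> P (s x - x).

(* A smooth projective geometrically integral curve over Q is encoded by its  *)
(* function field Q(C), a finitely generated field of transcendence degree 1  *)
(* in which Q is algebraically closed. The field Qbar(C) is the compositum    *)
(* of Qbar and Q(C), i.e. their tensor product over Q; both this field and    *)
(* the action of G_Q on it through the constants are determined by Q(C) up to *)
(* a unique isomorphism, and are kept in the record to avoid building them.   *)
Record curve := Curve {
  ratfun : fieldType;                                  (* Q(C) *)
  ratfunbar : fieldType;                               (* Qbar(C) *)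
  constQ : {rmorphism rat -> ratfun};
  constQbar : {rmorphism algC -> ratfunbar};
  extend : {rmorphism ratfun -> ratfunbar};
  galfun : GQ -> {rmorphism ratfunbar -> ratfunbar};
  curve_trdeg1 : exists x : ratfun,
    ~ algebraicOver constQ x /\
    exists (n : nat) (b : 'I_n -> ratfun), forall z : ratfun,
    exists (q : {poly rat}) (c : 'I_n -> {poly rat}),
      q != 0 /\
      z * (map_poly constQ q).[x] = \sum_i (map_poly constQ (c i)).[x] * b i;
  curve_geom_integral : forall z : ratfun,
    algebraicOver constQ z -> exists a : rat, z = constQ a;
  curve_compositum : forall z : ratfunbar, exists s : seq (algC * ratfun),
    z = \sum_(t <- s) constQbar t.1 * extend t.2;
  galfun_const : forall (s : GQ) (a : algC),
    galfun s (constQbar a) = constQbar (s a);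
  galfun_ratfun : forall (s : GQ) (f : ratfun), galfun s (extend f) = extend f
}.

(* A point of C(Qbar) is a normalised discrete valuation of Qbar(C) trivial   *)
(* on the constants; ord P 0 is set to the junk value 0.                      *)
Record point (C : curve) := Point {
  ord :> ratfunbar C -> int;
  ord0 : ord 0 = 0;
  ordM : forall f h, f != 0 -> h != 0 -> ord (f * h) = ord f + ord h;
  ordD : forall f h, f != 0 -> h != 0 -> f + h != 0 ->
    Num.min (ord f) (ord h) <= ord (f + h);
  ord_const : forall a : algC, ord (constQbar C a) = 0;
  ord_unif : exists t, ord t = 1
}.

HB.instance Definition _ (C : curve) := gen_eqMixin (point C).
HB.instance Definition _ (C : curve) := gen_choiceMixin (point C).

Definition divisor (C : curve) := {freeg (point C) / int}.
HB.instance Definition _ (C : curve) := GRing.Zmodule.on (divisor C).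

Definition is_div (C : curve) (f : ratfunbar C) (D : divisor C) : Prop :=
  f != 0 /\ forall P : point C, coeff P D = ord P f.

Section GaloisOnPoints.
Variables (C : curve) (s : GQ).

Lemma galfunK (z : ratfunbar C) : galfun C (algC_invaut s) (galfun C s z) = z.
Proof.
have [r ->] := curve_compositum z; rewrite !rmorph_sum /=; apply: eq_bigr => t _.
by rewrite !rmorphM /= !galfun_ratfun !galfun_const /= algC_autK.
Qed.

Variable P : point C.
Let o (f : ratfunbar C) : int := P (galfun C (algC_invaut s) f).

Let o0 : o 0 = 0. Proof. by rewrite /o rmorph0 ord0. Qed.
Let oM f h : f != 0 -> h != 0 -> o (f * h) = o f + o h.
Proof. by move=> f0 h0; rewrite /o rmorphM ordM // fmorph_eq0. Qed.
Let oD f h : f != 0 -> h != 0 -> f + h != 0 ->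
  Num.min (o f) (o h) <= o (f + h).
Proof.
by move=> f0 h0 fh0; rewrite /o rmorphD ordD // -?rmorphD fmorph_eq0.
Qed.
Let o_const (a : algC) : o (constQbar C a) = 0.
Proof. by rewrite /o galfun_const ord_const. Qed.
Let o_unif : exists t, o t = 1.
Proof. by have [t tP] := ord_unif P; exists (galfun C s t); rewrite /o galfunK. Qed.

(* The point s(P), characterised by ord_(s(P)) (s f) = ord_P f.               *)
Definition gal_point : point C := Point o0 oM oD o_const o_unif.
End GaloisOnPoints.

Definition gal_div (C : curve) (s : GQ) (D : divisor C) : divisor C :=
  \sum_(P <- dom D) << coeff P D *g gal_point s P >>.

Definition principal (C : curve) : {pred divisor C} :=
  fun D => `[< exists f, is_div f D >].

Lemma principal_zmod_closed (C : curve) : zmod_closed (@principal C).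
Proof.
have ord1 (P : point C) : P 1 = 0 by rewrite -(rmorph1 (constQbar C)) ord_const.
split=> [|D E].
  by apply/asboolP; exists 1; split=> [|P]; rewrite ?oner_neq0 // coeff0 ord1.
move=> /asboolP[f [f0 fD]] /asboolP[h [h0 hE]]; apply/asboolP; exists (f / h).
have hV0 : h^-1 != 0 by rewrite invr_eq0.
split=> [|P]; first by rewrite mulf_neq0.
rewrite coeffB fD hE ordM //; congr (_ + _); apply/eqP.
by rewrite eq_sym -addr_eq0 -ordM // mulVf // ord1.
Qed.

HB.instance Definition _ (C : curve) :=
  GRing.isZmodClosed.Build (divisor C) (@principal C) (principal_zmod_closed C).

Definition Pic (C : curve) := @Quotient.quot (divisor C) (@principal C).
HB.instance Definition _ (C : curve) := GRing.Zmodule.on (Pic C).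

Definition cls (C : curve) (D : divisor C) : Pic C := (\pi_(Pic C) D)%qT.

(* J(Qbar) = Pic^0 of the curve over Qbar.                                    *)
Definition jac (C : curve) (c : Pic C) : Prop :=
  exists2 D : divisor C, deg D = 0 & c = cls D.

Definition jac_torsion (C : curve) (l : nat) (c : Pic C) : Prop :=
  jac c /\ c *+ l = 0.

(* Independent of the representative, G_Q preserving principal divisors.      *)
Definition gal_cls (C : curve) (s : GQ) (c : Pic C) : Pic C :=
  cls (gal_div s (repr c)).

(* The genus, through Riemann's theorem: max over D of deg D + 1 - l(D).      *)
Definition RRspace (C : curve) (D : divisor C) (f : ratfunbar C) : Prop :=
  f = 0 \/ forall P : point C, 0 <= ord P f + coeff P D.

Definition RRdim (C : curve) (D : divisor C) (n : nat) : Prop :=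
  exists b : 'I_n -> ratfunbar C,
    (forall f, RRspace D f <->
       exists c : 'I_n -> algC, f = \sum_i constQbar C (c i) * b i) /\
    (forall c : 'I_n -> algC,
       \sum_i constQbar C (c i) * b i = 0 -> forall i, c i = 0).

Definition genus (C : curve) (g : nat) : Prop :=
  (forall (D : divisor C) n, RRdim D n -> deg D + 1 - n%:Z <= g%:Z) /\
  (exists (D : divisor C) n, RRdim D n /\ deg D + 1 - n%:Z = g%:Z).

(* The value at P of a function f regular at P.                               *)
Definition value_at (C : curve) (f : ratfunbar C) (P : point C) (a : algC) :=
  f = constQbar C a \/ 0 < ord P (f - constQbar C a).

(* f(E) = \prod_P f(P) ^ E(P).                                                *)
Definition value_div (C : curve) (f : ratfunbar C) (E : divisor C) (u : algC) :=
  exists w : point C -> algC,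
    (forall P, P \in dom E -> value_at f P (w P)) /\
    u = \prod_(P <- dom E) w P ^ coeff P E.

(* The Weil pairing on J[l], as the graph of a map to the l-th roots of unity *)
(* in Qbar: if c = [D], d = [E] with D, E of degree 0 and disjoint supports,  *)
(* l D = div f and l E = div h, then e_l(c, d) = f(E) / h(D).                 *)
Definition weil_pairing (C : curve) (l : nat) (c d : Pic C) (a : algC) : Prop :=
  exists (D E : divisor C) (f h : ratfunbar C) (u w : algC),
    [/\ c = cls D, d = cls E, deg D = 0 & deg E = 0] /\
    [/\ (forall P, ~~ ((P \in dom D) && (P \in dom E))),
        is_div f (D *+ l), is_div h (E *+ l),
        value_div f E u & value_div h D w] /\
    a = u / w.

(* The standard symplectic form on row vectors and its similitudes.           *)
Definition symp_mx (k : fieldType) (g : nat) : 'M[k]_(g + g) :=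
  block_mx 0 1%:M (- 1%:M) 0.

Definition symp_form (k : fieldType) (g : nat) (x y : 'rV[k]_(g + g)) : k :=
  (x *m symp_mx k g *m y^T) 0 0.

Definition GSp (k : fieldType) (g : nat) (A : 'M[k]_(g + g)) : Prop :=
  exists2 c : k, c != 0 & A *m symp_mx k g *m A^T = c *: symp_mx k g.

(* phi identifies F_l^2g with J[l] as a symplectic space: the images of the   *)
(* unit vectors form a symplectic basis of J[l] for the Weil pairing, whose   *)
(* values are written as powers of the root of unity zeta. An additive map is *)
(* F_l-linear, J[l] being killed by l.                                        *)
Record symplectic_basis (C : curve) (l g : nat) (zeta : algC)
    (phi : {additive 'rV['F_l]_(g + g) -> Pic C}) : Prop := SymplecticBasis {
  symplectic_basis_root : l.-primitive_root zeta;
  symplectic_basis_inj : injective phi;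
  symplectic_basis_onto : forall c, jac_torsion l c <-> exists v, c = phi v;
  symplectic_basis_weil : forall x y a,
    weil_pairing l (phi x) (phi y) a <->
    a = zeta ^+ nat_of_ord (symp_form x y)
}.

(* rho s is the matrix of s acting on J[l] (on row vectors, from the right).  *)
Definition matrix_action (C : curve) (l g : nat)
    (phi : {additive 'rV['F_l]_(g + g) -> Pic C})
    (rho : GQ -> 'M['F_l]_(g + g)) : Prop :=
  forall (s : GQ) v, phi (v *m rho s) = gal_cls s (phi v).

Definition irreducible_rep (k : fieldType) (n : nat) (rho : GQ -> 'M[k]_n) :=
  (0 < n)%N /\
  forall U : 'M[k]_n, (forall s, stablemx U (rho s)) ->
    U = 0 \/ row_full U.

Definition nondegenerate_on (k : fieldType) (g : nat) (U : 'M[k]_(g + g)) :=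
  forall x : 'rV[k]_(g + g), (x <= U)%MS ->
    (forall y : 'rV[k]_(g + g), (y <= U)%MS -> symp_form x y = 0) -> x = 0.

(* The subspaces are the row spaces of the V i; orthogonality is not required. *)
Definition stable_symplectic_decomposition (k : fieldType) (g m : nat)
    (rho : GQ -> 'M[k]_(g + g)) (V : 'I_m -> 'M[k]_(g + g)) : Prop :=
  [/\ mxdirect (\sum_i V i)%MS, row_full (\sum_i V i)%MS,
      (forall i, nondegenerate_on (V i)) &
      (forall s i, exists j, (V i *m rho s == V j)%MS)].

Definition unramified_decompositions (k : fieldType) (g : nat)
    (rho : GQ -> 'M[k]_(g + g)) : Prop :=
  forall m (V : 'I_m -> 'M[k]_(g + g)),
    stable_symplectic_decomposition rho V ->
    forall p (P : algC -> Prop), prime p -> prime_above p P ->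
    forall s, inertia P s -> forall i, (V i *m rho s == V i)%MS.

Definition Fbar (l : nat) : closedFieldType :=
  tag (countable_algebraic_closure 'F_l).

Definition Fbar_inj (l : nat) : {rmorphism 'F_l -> Fbar l} :=
  sval (tagged (countable_algebraic_closure 'F_l)).

Definition scalar_extension (l n : nat) (rho : GQ -> 'M['F_l]_n) :
    GQ -> 'M[Fbar l]_n :=
  fun s => map_mx (Fbar_inj l) (rho s).

Definition absolutely_irreducible (l n : nat) (rho : GQ -> 'M['F_l]_n) :=
  irreducible_rep (scalar_extension rho).

Definition quasi_unramified (l g : nat) (rho : GQ -> 'M['F_l]_(g + g)) :=
  unramified_decompositions rho.

Definition strongly_quasi_unramified (l g : nat)
    (rho : GQ -> 'M['F_l]_(g + g)) :=
  unramified_decompositions (scalar_extension rho).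

Definition transvection (k : fieldType) (n : nat) (A : 'M[k]_n) : Prop :=
  (exists m : nat, (A - 1%:M) ^+ m = 0) /\ \rank (A - 1%:M) = 1%N.

Definition image_is_GSp (l g : nat) (rho : GQ -> 'M['F_l]_(g + g)) : Prop :=
  forall A : 'M['F_l]_(g + g), GSp A <-> exists s, rho s = A.

(* Main.v *)
(* Write G for the image of rho, S for the set of all v such that every       *)
(* transvection with center v lies in G, and <,> for the symplectic form. As  *)
(* F_l is a prime field, S is stable under scalars and under G, and if v, w   *)
(* in S are not orthogonal then S contains the plane they span. The connected *)
(* components of S for non-orthogonality span a G_Q-stable decomposition into *)
(* symplectic subspaces; it is unramified, hence trivial since Q has no       *)
(* unramified extension, so by irreducibility S is connected. Since l is odd  *)
(* this makes S stable under addition, so S is the whole space and G contains *)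
(* all transvections, which generate Sp. Galois equivariance of the Weil      *)
(* pairing puts G inside GSp, with all multipliers by irreducibility of the   *)
(* cyclotomic polynomials.                                                    *)
(*                                                                            *)
(* That Q has no unramified extension is proved for an action of G_Q on a     *)
(* finite set with trivial inertia at x. Let O be the ring of algebraic       *)
(* integers fixed by the stabilizer of x. For s moving x the elements s b -   *)
(* b, b in O, generate the unit ideal: otherwise a prime containing them has  *)
(* an inertia element in the coset of s. Multiplying these relations over the *)
(* cosets gives a_i, b_i with sum a_i s(b_i) = 1 if s fixes x, and 0          *)
(* otherwise. The b_i span a lattice on which the matrix of embeddings has a  *)
(* unit determinant, and Minkowski's theorem on linear forms yields a nonzero *)
(* integer of norm < 1 as soon as there are two embeddings.                   *)

From mathcomp Require Import boolp classical_sets.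
Require Import Defs.
From HB Require Import structures.
From mathcomp Require Import all_boot all_order all_algebra all_field all_fingroup.
From mathcomp Require Import freeg zify ring.

Set Implicit Arguments.
Unset Strict Implicit.
Unset Printing Implicit Defensive.

Import Order.TTheory GRing.Theory Num.Theory.
Local Open Scope ring_scope.

(** * The absolute Galois group of Q *)

(** Two results meet in [image_GSp]. The arithmetic one is [unramified_trivial]: a point of a finite
    set with continuous G_Q-action that is fixed by all inertia groups is fixed by G_Q. In
    [rho_decomposition] it is applied to the set of vectors of a summand, so every summand of every
    stable symplectic decomposition is G_Q-stable. The group-theoretic one is [all_transv]: over a
    prime field of odd characteristic, an irreducible group of similitudes that contains a
    transvection and stabilizes each summand of every symplectic decomposition it permutes contains
    all transvections, hence Sp by [transv_generate]. By [weil_pairing_gal] the multiplier of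
    [rho s] is the mod l cyclotomic character ([rho_simil]), which takes every nonzero value; so the
    image is GSp.

    For [unramified_trivial], let O be the ring of integers of the field K fixed by the stabilizer
    of x0. If s moves x0, the differences s b - b with b in O generate the unit ideal
    ([unit_ideal]): modulo a prime containing them, s is trivial on O and can be corrected by the
    stabilizer to be trivial on any finite set of integers ([inertia_lift_finite]), then on all
    integers by compactness ([GQ_compact]), which gives an inertia element moving x0. These
    relations yield dual families ([dual_pairs]), hence elements of O whose matrix of conjugates has
    determinant of modulus 1 ([unimodular_basis]). [minkowski_strict] then excludes a second
    embedding of K ([unimodular_basis_trivial]). *)

Lemma GQ_conj (x y : algC) : root (minCpoly x) y -> exists s : GQ, s x = y.
Proof.
move=> rooty; have [p [Dp mon_p] div_p] := minCpolyP x.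
have [r Dr] := closed_field_poly_normal (minCpoly x).
rewrite (monicP (minCpoly_monic x)) scale1r in Dr.
(* The number field generated by all conjugates of x is normal, so one of its automorphisms carries
   x to y; it then extends to [algC]. *)
have [L [LC [r1 Dr1 genL]]] := num_field_exists r.
have mapLC (q : {poly rat}) : map_poly LC (map_poly (in_alg L) q) = map_poly ratr q.
  rewrite -map_poly_comp; apply: eq_map_poly => a /=.
  by rewrite alg_num_field fmorph_rat.
have Dpr1 : map_poly (in_alg L) p = \prod_(z <- r1) ('X - z%:P).
  apply: (map_poly_inj LC); rewrite mapLC -Dp Dr -Dr1 big_map rmorph_prod /=.
  by apply: eq_bigr => z _; rewrite map_polyXsubC.
have splitL : SplittingField.axiom L.
  exists (map_poly (in_alg L) p); first by apply/polyOver1P; exists p.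
  by exists r1 => //; rewrite -Dpr1 eqpxx.
pose LsM := FieldExt_isSplittingField.Build rat L splitL.
pose Ls : splittingFieldType rat := HB.pack L LsM.
have inL z : root (minCpoly x) z -> exists z1 : L, LC z1 = z.
  by rewrite Dr root_prod_XsubC -Dr1 => /mapP[z1 _ ->]; exists z1.
have [x1 Dx] := inL x (root_minCpoly x); have [y1 Dy] := inL y rooty.
have rooty1 : root (minPoly 1 (x1 : Ls)) y1.
  have /polyOver1P[q Dq] := minPolyOver 1 (x1 : Ls).
  rewrite -(fmorph_root LC) Dq mapLC Dy.
  have : root (map_poly ratr q) x by rewrite -mapLC -Dq -Dx fmorph_root root_minPoly.
  by rewrite div_p => /dvdpP[c ->]; rewrite rmorphM /= rootM -Dp rooty orbT.
have [g _ Dg] := @normalField_root_minPoly rat Ls 1%AS {:Ls}%AS x1 y1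
  (subvf _) (normalFieldf _) (memvf _) rooty1.
have [nu Dnu] := extend_algC_subfield_aut LC (gal_repr g : {rmorphism L -> L}).
by exists nu; rewrite -Dx -Dnu -Dy; congr (LC _).
Qed.

(** All roots of the minimal polynomial are conjugate to x, hence equal to x, and their sum is
    rational. *)
Lemma GQ_fixed_rat (x : algC) : (forall s : GQ, s x = x) -> x \in Crat.
Proof.
move=> fix_x; have [r Dr] := closed_field_poly_normal (minCpoly x).
have [p [Dp mon_p] div_p] := minCpolyP x.
rewrite (monicP (minCpoly_monic x)) scale1r in Dr.
have rx z : z \in r -> z = x.
  by rewrite -root_prod_XsubC -Dr => /GQ_conj[s <-]; rewrite fix_x.
have r_gt0 : size r != 0%N.
  by have := size_minCpoly x; rewrite Dr size_prod_XsubC ltnS -lt0n.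
have := coefPn_prod_XsubC r_gt0; rewrite -Dr Dp coef_map /=.
rewrite [\sum_(z <- r) z](eq_big_seq (fun=> x)) // big_const_seq count_predT.
rewrite iter_addr_0 => /eqP; rewrite -eqr_oppLR => /eqP Dx.
have : x *+ size r \in Crat by rewrite -Dx rpredN Crat_rat.
rewrite -mulr_natr => xr; rewrite -[x](@mulfK _ (size r)%:R) ?pnatr_eq0 //.
by rewrite rpred_div ?rpred_nat.
Qed.

(** Compactness of G_Q, in the manner of König's lemma: the values of s are chosen one by one along
    an enumeration of [algC], each prefix staying compatible with every finite set of
    constraints. *)
Lemma GQ_compact (Q : algC -> algC -> Prop) :
    (forall xs : seq algC, exists s : GQ, forall x, x \in xs -> Q x (s x)) ->
  exists s : GQ, forall x, Q x (s x).
Proof.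
move=> finQ; pose e (n : nat) : algC := odflt 0 (unpickle n).
pose good (v : seq algC) := forall xs : seq algC, exists s : GQ,
  (forall x, x \in xs -> Q x (s x)) /\ forall i, (i < size v)%N -> s (e i) = v`_i.
have good0 : good [::] by move=> xs; have [s sP] := finQ xs; exists s.
have goodS v : exists y, good v -> good (rcons v y).
  have [gv|] := pselect (good v); last by exists 0.
  apply: contrapT => /forallNP bad; set k := size v.
  have {}bad y : exists xs : seq algC, ~ exists s : GQ, (forall x, x \in xs -> Q x (s x)) /\
    forall i, (i < size (rcons v y))%N -> s (e i) = (rcons v y)`_i.
    by apply/existsNP => gvy; apply: (bad y).
  have [X XP] := boolp.choice bad.
  have [r Dr] := closed_field_poly_normal (minCpoly (e k)).
  rewrite (monicP (minCpoly_monic _)) scale1r in Dr.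
  (* Only the finitely many conjugates of [e k] are possible values; the obstructions to all of them
     together form one finite set of constraints. *)
  have [s [sQ sv]] := gv (flatten (map X r)).
  have yr : s (e k) \in r.
    by rewrite -root_prod_XsubC -Dr -(minCpoly_aut s) root_minCpoly.
  case: (XP (s (e k))); exists s; split=> [x xX|i].
    by apply/sQ/flattenP; exists (X (s (e k))); rewrite ?map_f.
  rewrite size_rcons ltnS nth_rcons -/k leq_eqVlt.
  by have [->|_ /= ltik] := eqVneq i k; rewrite ?ltnn // ltik sv.
have [f fP] := boolp.choice goodS.
pose V n := iter n (fun v => rcons v (f v)) [::].
have sizeV n : size (V n) = n by elim: n => //= n IHn; rewrite size_rcons IHn.
have goodV n : good (V n) by elim: n => //= n IHn; apply: fP.
have nthV m n i : (i < m)%N -> (m <= n)%N -> (V n)`_i = (V m)`_i.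
  move=> ltim; elim: n => [|n IHn]; first by rewrite leqn0 => /eqP->.
  rewrite leq_eqVlt => /predU1P[-> //|]; rewrite ltnS => lemn.
  by rewrite /= nth_rcons sizeV (leq_trans ltim lemn) IHn.
pose g (x : algC) : algC := (V (pickle x).+1)`_(pickle x).
have gP (zs : seq algC) : exists s : GQ, forall x, x \in zs -> Q x (s x) /\ s x = g x.
  pose N := \max_(x <- zs) (pickle x).+1.
  have [s [sQ sV]] := goodV N zs; exists s => x xzs; split; first exact: sQ.
  have ltxN : (pickle x < N)%N by rewrite /N (big_rem x) //= leq_max ltnSn.
  by rewrite /g -(nthV _ N) // -sV ?sizeV // /e pickleK.
have gB : zmod_morphism g.
  move=> x y; have [s sP] := gP [:: x - y; x; y].
  have [|/= _ <-] := sP (x - y); first by rewrite inE eqxx.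
  have [|/= _ <-] := sP x; first by rewrite !inE eqxx orbT.
  have [|/= _ <-] := sP y; first by rewrite !inE eqxx !orbT.
  exact: rmorphB.
have gM : monoid_morphism g.
  split=> [|x y].
    by have [s /(_ 1)[|_ <-]] := gP [:: 1]; rewrite ?inE // rmorph1.
  have [s sP] := gP [:: x * y; x; y].
  have [|/= _ <-] := sP (x * y); first by rewrite inE eqxx.
  have [|/= _ <-] := sP x; first by rewrite !inE eqxx orbT.
  have [|/= _ <-] := sP y; first by rewrite !inE eqxx !orbT.
  exact: rmorphM.
pose gBM := GRing.isZmodMorphism.Build algC algC g gB.
pose gMM := GRing.isMonoidMorphism.Build algC algC g gM.
pose gRM : GQ := HB.pack g gBM gMM.
exists gRM => x; have [s /(_ x)[|Qx gx]] := gP [:: x]; first by rewrite inE.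
by rewrite /= -gx.
Qed.

(** * Prime ideals of the ring of algebraic integers *)

Definition Aint_ideal (A : algC -> Prop) : Prop :=
  [/\ forall x, A x -> x \in Aint, A 0, forall x y, A x -> A y -> A (x + y)
    & forall a x, a \in Aint -> A x -> A (a * x)].

(** Zorn's lemma; maximality is recorded as invertibility modulo A of every integer outside A. *)
Lemma Aint_maximal_ideal (J : algC -> Prop) :
    Aint_ideal J -> ~ J 1 ->
  exists2 A, Aint_ideal A /\ (forall x, J x -> A x) &
    ~ A 1 /\ forall x, x \in Aint -> ~ A x -> exists2 a, a \in Aint & A (1 - a * x).
Proof.
move=> idJ nJ1.
pose P (S : set algC) := S = classical_sets.set0 \/ [/\ Aint_ideal S, forall x, J x -> S x & ~ S 1].
have [F FP Ftot|A [PA maxA]] := @Zorn_bigcup algC P.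
  have [allF0|] := pselect (forall S, F S -> S = classical_sets.set0).
    by left; apply/seteqP; split=> // x [S /allF0->].
  move=> /existsNP[S /not_implyP[FS nS0]]; right.
  have idF X : F X -> (exists x, X x) -> [/\ Aint_ideal X, forall x, J x -> X x & ~ X 1].
    by move=> FX [x Xx]; have [X0|//] := FP X FX; rewrite X0 in Xx.
  have exS : exists x, S x by apply: contrapT => /forallNP nS; apply: nS0; apply/seteqP; split.
  have [[_ S0 _ _] SJ _] := idF S FS exS.
  split; [split|move=> x Jx; exists S; auto|].
  - by move=> x [X FX Xx]; have [|[] subX] := idF X FX; [exists x|auto].
  - by exists S.
  - move=> x y [X FX Xx] [Y FY Yy].
    have [[_ _ XD _] _ _] := idF X FX (ex_intro _ x Xx).
    have [[_ _ YD _] _ _] := idF Y FY (ex_intro _ y Yy).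
    by have [XY|YX] := Ftot X Y FX FY; [exists Y|exists X]; auto.
  - move=> a x aA [X FX Xx]; have [[_ _ _ XM] _ _] := idF X FX (ex_intro _ x Xx).
    by exists X; auto.
  - by move=> [X FX X1]; have [] := idF X FX (ex_intro _ 1 X1).
have idA : [/\ Aint_ideal A, forall x, J x -> A x & ~ A 1].
  case: PA => // A0; case: (maxA J); last by right.
  by rewrite A0; split=> // sJ; case: idJ => _ J0 _ _; case: (sJ 0).
have [[subA A0 AD AM] JA nA1] := idA.
exists A => //; split=> // x xA nAx.
pose B : set algC := fun z => exists2 a, a \in Aint & A (z - a * x) /\ z \in Aint.
have AB : (A `<` B)%classic.
  split=> [z Az|sBA]; first by exists 0; rewrite ?rpred0 // mul0r subr0; auto.
  by apply/nAx/sBA; exists 1; rewrite ?rpred1 // mul1r subrr.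
apply: contrapT => nB1; case: (maxA B AB); right; split.
- split=> [z [a _ []] //||y z [a aA [Ay yA]] [b bA [Az zA]]|c z cA [a aA [Az zA]]].
  + by exists 0; rewrite ?rpred0 // mul0r subrr.
  + by exists (a + b); rewrite ?rpredD // mulrDl opprD addrACA; auto.
  + by exists (c * a); rewrite ?rpredM // -mulrA -mulrBr; auto.
- by move=> z /JA Az; exists 0; rewrite ?rpred0 // mul0r subr0; auto.
- by move=> [a aA [Aa _]]; apply: nB1; exists a.
Qed.

(** A maximal ideal is prime, and it contains a positive integer, namely the norm of a nonzero
    element up to sign; hence it contains a prime factor of that integer. *)
Lemma Aint_prime_ideal (J : algC -> Prop) :
    Aint_ideal J -> ~ J 1 ->
  exists p P, [/\ prime p, Defs.prime_above p P & forall x, J x -> P x].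
Proof.
move=> idJ nJ1; have [A [[subA A0 AD AM] JA] [nA1 maxA]] := Aint_maximal_ideal idJ nJ1.
have primeA x y : x \in Aint -> y \in Aint -> A (x * y) -> A x \/ A y.
  move=> xA yA Axy; have [|nAx] := pselect (A x); [by left|right].
  have [a aA Aa] := maxA x xA nAx.
  have -> : y = y * (1 - a * x) + a * (x * y) by rewrite mulrBr mulr1 mulrCA (mulrC y) subrK.
  by auto.
suffices [m m_gt0 Am] : exists2 m : nat, (0 < m)%N & A m%:R.
  suffices [p prp Ap] : exists2 p, prime p & A p%:R by exists p, A; split=> //; split.
  elim: m {-2}m (leqnn m) m_gt0 Am => [[]//|n IHn] m lemn m_gt0 Am.
  have [m1|m_gt1] := leqP m 1; first by have m1' : m = 1%N by [apply/anti_leq/andP]; rewrite m1' in Am.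
  have prp := pdiv_prime m_gt1; move: Am.
  rewrite -(divnK (pdiv_dvd m)) natrM => /primeA[||Am|]; rewrite ?Aint_Cnat ?natr_nat //.
    apply: (IHn (m %/ pdiv m)%N) => //; last by rewrite divn_gt0 ?pdiv_gt0 // pdiv_leq.
    by rewrite -ltnS (leq_trans _ lemn) // ltn_Pdiv // prime_gt1.
  by exists (pdiv m).
(* This produces a nonzero element of A even when J is zero: either 2, or 1 - 2a, which is nonzero
   since 1/2 is not integral. *)
have [A2|nA2] := pselect (A 2%:R); first by exists 2%N.
have [a aA Aa] := maxA 2%:R (Aint_Cnat (natr_nat _ 2)) nA2.
set b := 1 - _ in Aa; have b0 : b != 0.
  apply/eqP=> /eqP; rewrite subr_eq0 => /eqP Da.
  have : a \in Num.int.
    apply: Cint_rat_Aint => //; have -> : a = 1 / 2%:R by rewrite [X in X / _]Da mulfK ?pnatr_eq0.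
    by rewrite rpred_div ?rpred_nat ?rpred1.
  move=> /intrP[z Dz].
  have /intr_inj : 1%:~R = (z * 2)%:~R :> algC by rewrite intrM -Dz; exact: Da.
  by move=> /(congr1 (fun z : int => odd `|z|%N)); rewrite abszM oddM andbF.
have [r Dr] := closed_field_poly_normal (minCpoly b).
rewrite (monicP (minCpoly_monic _)) scale1r in Dr.
have br : b \in r by rewrite -root_prod_XsubC -Dr root_minCpoly.
have conj_r z : z \in r -> exists s : GQ, z = s b.
  by rewrite -root_prod_XsubC -Dr => /GQ_conj[s <-]; exists s.
have rA z : z \in r -> z \in Aint by move=> /conj_r[s ->]; rewrite Aint_aut subA.
pose N := \prod_(z <- r) z.
have AN : A N.
  rewrite /N (big_rem b) //= mulrC; apply: AM => //; rewrite big_seq rpred_prod // => z zr.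
  by rewrite rA // (mem_rem zr).
have N0 : N != 0.
  rewrite prodf_seq_neq0; apply/allP=> z /conj_r[s ->] /=; by rewrite fmorph_eq0.
have /intrP[m Dm] : N \in Num.int.
  have : (minCpoly b)`_0 \in Num.int by apply/polyOverP/subA.
  have -> : (minCpoly b)`_0 = (-1) ^+ size r * N.
    by rewrite Dr coef0_prod_XsubC.
  by move=> /(rpredM (rpredX (size r) (rpredN1 _))); rewrite mulrA -exprMn mulrN1 opprK expr1n mul1r.
exists `|m|%N; first by rewrite absz_gt0; apply: contraNneq N0 => m0; rewrite Dm m0.
have -> : (`|m|%N%:R : algC) = (sgz m)%:~R * N.
  by rewrite Dm -intrM -abszEsg pmulrn.
by apply: AM => //; rewrite Aint_int.
Qed.

(** * Gauss's lemma modulo a prime ideal *)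

Section PolyIdeal.
Variables (p : nat) (P : algC -> Prop).
Hypothesis Pp : Defs.prime_above p P.

Lemma prime_above0 : P 0.
Proof.
by rewrite -(mul0r p%:R); apply: (prime_aboveM Pp); [exact: rpred0|exact: prime_above_p Pp].
Qed.

Lemma prime_aboveN x : P x -> P (- x).
Proof. by move/(prime_aboveM Pp (rpredN1 _)); rewrite mulN1r. Qed.

Lemma prime_above_sum (I : eqType) (r : seq I) (Q : pred I) (F : I -> algC) :
  (forall i, i \in r -> Q i -> P (F i)) -> P (\sum_(i <- r | Q i) F i).
Proof.
move=> PF; rewrite big_seq_cond; apply: (big_ind P) => [||i /andP[ri Qi]].
- exact: prime_above0.
- exact: (prime_aboveD Pp).
- exact: PF.
Qed.

Definition coefs_in (q : {poly algC}) : Prop := forall i, P q`_i.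

(** If i and j are the least indices of coefficients of q and r outside P, then the coefficient of
    index i + j of the product is outside P. *)
Lemma coefs_in_prime (q r : {poly algC}) :
    q \is a polyOver Aint -> r \is a polyOver Aint ->
  coefs_in (q * r) -> coefs_in q \/ coefs_in r.
Proof.
move=> /polyOverP qA /polyOverP rA Pqr; apply: contrapT => /not_orP[].
move=> /existsNP[i0 /asboolPn nPi] /existsNP[j0 /asboolPn nPj].
have exi : exists i, ~~ `[< P q`_i >] by exists i0.
have exj : exists j, ~~ `[< P r`_j >] by exists j0.
case: (ex_minnP exi) => i /asboolP nPqi mini; case: (ex_minnP exj) => j /asboolP nPrj minj.
have := Pqr (i + j)%N; rewrite coefM.
have lti : (i < (i + j).+1)%N by rewrite ltnS leq_addr.
rewrite (bigD1 (Ordinal lti)) //= addKn => Psum.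
suffices /(prime_aboveD Pp Psum) : P (- \sum_(k < (i + j).+1 | k != Ordinal lti) q`_k * r`_(i + j - k)).
  by rewrite addrK => /(prime_above_prime Pp (qA _) (rA _))[].
apply/prime_aboveN/prime_above_sum => k _; rewrite -val_eqE /= => neqk.
have [ltki|leik] := ltnP k i.
  rewrite mulrC; apply: (prime_aboveM Pp) => //; apply: contrapT => /asboolPn /mini.
  by rewrite leqNgt ltki.
apply: (prime_aboveM Pp) => //; apply: contrapT => /asboolPn /minj.
rewrite leqNgt; case/negP; rewrite ltn_subLR; last by rewrite -ltnS.
by rewrite ltn_add2r ltn_neqAle eq_sym neqk.
Qed.

Lemma coefs_in_prime_prod (I : eqType) (s : seq I) (F : I -> {poly algC}) :
    (forall i, i \in s -> F i \is a polyOver Aint) ->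
  coefs_in (\prod_(i <- s) F i) -> exists2 i, i \in s & coefs_in (F i).
Proof.
elim: s => [_|i s IHs FA].
  by rewrite big_nil => /(_ 0); rewrite coef1 => /(prime_above_proper Pp).
have FsA j : j \in s -> F j \is a polyOver Aint by move=> js; rewrite FA // inE js orbT.
rewrite big_cons => /coefs_in_prime[||PFi|].
- by rewrite FA ?mem_head.
- by rewrite big_seq rpred_prod.
- by exists i; rewrite ?mem_head.
by move=> /(IHs FsA)[j js PFj]; exists j; rewrite // inE js orbT.
Qed.

Lemma coefs_inM (q r : {poly algC}) :
  q \is a polyOver Aint -> coefs_in r -> coefs_in (q * r).
Proof.
move=> /polyOverP qA Pr i; rewrite coefM; apply: prime_above_sum => j _ _.
exact: (prime_aboveM Pp).
Qed.

End PolyIdeal.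

(** * Lifting inertia from finite quotients *)

Definition GQcomp (s t : GQ) : GQ := s \o t.
Definition GQinv (s : GQ) : GQ := algC_invaut s.

Lemma GQ_finite_conj (H : GQ -> Prop) (f : {poly algC}) :
  exists2 O : seq {poly algC}, uniq O &
    forall q, q \in O <-> exists2 s : GQ, H s & q = map_poly s f.
Proof.
suffices [L LP] : exists L : seq {poly algC}, forall s : GQ, map_poly s f \in L.
  pose Q q := `[< exists2 s : GQ, H s & q = map_poly s f >].
  exists (undup (filter Q L)); first exact: undup_uniq.
  move=> q; rewrite mem_undup mem_filter; split=> [/andP[/asboolP]//|[s Hs ->]].
  by rewrite LP andbT; apply/asboolP; exists s.
elim/poly_ind: f => [|f c [L LP]]; first by exists [:: 0] => s; rewrite rmorph0 inE.
have [r Dr] := closed_field_poly_normal (minCpoly c).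
rewrite (monicP (minCpoly_monic _)) scale1r in Dr.
exists [seq q * 'X + d%:P | q <- L, d <- r] => s.
rewrite rmorphD rmorphM /= map_polyX map_polyC /=; apply/allpairsP.
exists (map_poly s f, s c); split=> //=.
by rewrite -root_prod_XsubC -Dr -(minCpoly_aut s) root_minCpoly.
Qed.

Section Unramified.
Variables (T : finType) (act : GQ -> T -> T) (x0 : T) (X : seq algC).
Hypothesis act_comp : forall s t u : GQ,
  (forall x, u x = s (t x)) -> forall p, act u p = act s (act t p).
Hypothesis act_cont : forall s : GQ, {in X, s =1 id} -> forall p, act s p = p.
Hypothesis unram : forall p P, prime p -> Defs.prime_above p P ->
  forall s : GQ, inertia P s -> act s x0 = x0.

Let act_invK (s : GQ) p : act (GQinv s) (act s p) = p.
Proof.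
rewrite -(@act_comp _ _ (GQcomp (GQinv s) s)) // act_cont // => x _.
by rewrite /= algC_autK.
Qed.

Let act_Kinv (s : GQ) p : act s (act (GQinv s) p) = p.
Proof.
rewrite -(@act_comp _ _ (GQcomp s (GQinv s))) // act_cont // => x _.
by rewrite /= algC_invautK.
Qed.

(** The ring O of integers of the field fixed by the stabilizer of x0; the embeddings of this field
    correspond to the orbit of x0. *)
Definition stab_int (b : algC) : Prop :=
  b \in Aint /\ forall h : GQ, act h x0 = x0 -> h b = b.

Lemma stab_int_coset (s t : GQ) b :
  act s x0 = act t x0 -> stab_int b -> s b = t b.
Proof.
move=> Dst [_ fixb]; apply: (can_inj (algC_autK (GQinv t))).
have := fixb (GQcomp (GQinv t) s); rewrite (@act_comp (GQinv t) s) // Dst act_invK.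
move=> /(_ erefl) /= E; have /= := fixb (GQcomp (GQinv t) t).
rewrite (@act_comp (GQinv t) t) // act_invK => /(_ erefl) /= E2.
by rewrite E E2.
Qed.

Lemma stab_int_subring : [/\ stab_int 1, forall x y, stab_int x -> stab_int y -> stab_int (x * y)
  & forall x y, stab_int x -> stab_int y -> stab_int (x - y)].
Proof.
split=> [|x y [xA fx] [yA fy]|x y [xA fx] [yA fy]].
- by split=> [|h _]; rewrite ?rpred1 ?rmorph1.
- by split=> [|h Hh]; rewrite ?rpredM // rmorphM fx // fy.
- by split=> [|h Hh]; rewrite ?rpredB // rmorphB fx // fy.
Qed.

(* The product F of Y - h f over the conjugates h f of f = \sum_i b_i X^i by *)
(* the stabilizer has coefficients fixed by the latter, so F and its image   *)
(* by s agree modulo P, and f is a root modulo P of the image.               *)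
Lemma inertia_lift_finite p (P : algC -> Prop) (s : GQ) (f : {poly algC}) :
    Defs.prime_above p P -> (forall x, stab_int x -> P (s x - x)) ->
    f \is a polyOver Aint ->
  exists2 t : GQ, act t x0 = act s x0 & forall i, P (t f`_i - f`_i).
Proof.
move=> Pp inert_s fA.
have mapA (h : GQ) q : q \is a polyOver Aint -> map_poly h q \is a polyOver Aint.
  by move=> /polyOverP qA; apply/polyOverP=> i; rewrite coef_map Aint_aut.
have [O uO OP] := GQ_finite_conj (fun h => act h x0 = x0) f.
have OA q : q \in O -> q \is a polyOver Aint by move=> /OP[h _ ->]; apply: mapA.
pose F : {poly {poly algC}} := \prod_(q <- O) ('X - q%:P).
have mapF (h : GQ) : map_poly (map_poly h) F = \prod_(q <- O) ('X - (map_poly h q)%:P).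
  rewrite rmorph_prod; apply: eq_bigr => q _.
  by rewrite rmorphB /= map_polyX map_polyC.
have FA j : F`_j \is a polyOver Aint.
  rewrite /F big_seq; move: j; pose K (G : {poly {poly algC}}) := forall j, G`_j \is a polyOver Aint.
  apply: (big_ind K) => [j|G G' GA G'A j|q qO j].
  - by rewrite coef1 rpred_nat.
  - by rewrite coefM rpred_sum // => k _; rewrite rpredM.
  - rewrite coefB coefX coefC; apply: rpredB; first exact: rpred_nat.
    by case: eqP; rewrite ?rpred0 // OA.
have Fint i j : stab_int F`_j`_i.
  split=> [|h Hh]; first exact: (polyOverP (FA j)).
  suffices Fh : map_poly (map_poly h) F = F by rewrite -{2}Fh !coef_map.
  rewrite mapF -(big_map (map_poly h) predT (fun q => 'X - q%:P)); apply: perm_big.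
  apply: uniq_perm => //; first by rewrite map_inj_uniq //; apply/map_poly_inj.
  move=> q; apply/mapP/idP => [[q1 /OP[h1 Hh1 ->] ->]|/OP[h1 Hh1 ->]].
    apply/OP; exists (GQcomp h h1); last by rewrite -map_poly_comp.
    by rewrite (@act_comp h h1) // Hh1.
  exists (map_poly (GQcomp (GQinv h) h1) f).
    apply/OP; exists (GQcomp (GQinv h) h1) => //.
    by rewrite (@act_comp (GQinv h) h1) // Hh1 -{1}Hh act_invK.
  by rewrite -map_poly_comp; apply: eq_map_poly => x /=; rewrite algC_invautK.
have Ff : F.[f] = 0.
  apply/eqP; rewrite -[_ == 0]/(root F f) root_prod_XsubC; apply/OP.
  exists idfun; first by rewrite act_cont.
  by rewrite map_poly_id.
have PsF : coefs_in P (map_poly (map_poly s) F).[f].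
  rewrite -[X in coefs_in P X]subr0 -Ff -hornerN -hornerD horner_coef => i.
  rewrite coef_sum; apply: (prime_above_sum Pp) => j _ _; rewrite mulrC.
  apply: (coefs_inM Pp) => [|k]; first by rewrite rpredX.
  by rewrite coefB !coef_map /= coefB coef_map; apply: inert_s.
rewrite mapF horner_prod in PsF.
have [|q /OP[h Hh ->] Pq] := coefs_in_prime_prod Pp _ PsF.
  by move=> q qO; rewrite hornerXsubC rpredB // mapA // OA.
exists (GQcomp s h); first by rewrite (@act_comp s h) // Hh.
move=> i; have := Pq i; rewrite hornerXsubC coefB !coef_map /=.
by move/(prime_aboveN Pp); rewrite opprB.
Qed.

Lemma unit_ideal (s : GQ) : act s x0 <> x0 ->
  exists2 cs : seq (algC * algC),
    forall c, c \in cs -> c.1 \in Aint /\ stab_int c.2 &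
    \sum_(c <- cs) c.1 * (s c.2 - c.2) = 1.
Proof.
move=> sx0; apply: contrapT => nJ1.
pose J z := exists2 cs : seq (algC * algC),
    forall c, c \in cs -> c.1 \in Aint /\ stab_int c.2 &
    \sum_(c <- cs) c.1 * (s c.2 - c.2) = z.
have idJ : Aint_ideal J.
  split=> [_ [cs csP <-]||_ _ [cs csP <-] [ds dsP <-]|a _ aA [cs csP <-]].
  - rewrite big_seq rpred_sum // => c /csP[c1A [c2A _]].
    by rewrite rpredM // rpredB // Aint_aut.
  - by exists [::]; rewrite ?big_nil.
  - exists (cs ++ ds); last by rewrite big_cat.
    by move=> c; rewrite mem_cat => /orP[/csP|/dsP].
  - exists [seq (a * c.1, c.2) | c <- cs].
      by move=> _ /mapP[c /csP[c1A c2P] ->] /=; rewrite rpredM.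
    by rewrite big_map mulr_sumr; apply: eq_bigr => c _; rewrite mulrA.
have [p [P [prp Pp JP]]] := Aint_prime_ideal idJ nJ1.
have inert_s x : stab_int x -> P (s x - x).
  move=> xP; apply: JP; exists [:: (1, x)]; last by rewrite big_seq1 mul1r.
  by move=> c; rewrite inE => /eqP-> /=; rewrite rpred1.
(* With z a primitive element for X, the image of x0 under an automorphism depends only on its value
   at z. So lying in the coset of s becomes a pointwise condition, to which compactness applies. *)
have [z _ [ps Dps]] := algC_PET X.
have fixX (t : GQ) : t z = z -> {in X, t =1 id}.
  move=> tz x; rewrite Dps => /mapP[q _ ->]; rewrite -horner_map tz -map_poly_comp.
  by congr _.[z]; apply: eq_map_poly => c /=; rewrite fmorph_rat.
pose Q (x y : algC) := (x \in Aint -> P (y - x)) /\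
  (x = z -> exists2 t : GQ, act t x0 = act s x0 & y = t z).
have [xs|t tQ] := @GQ_compact Q.
  (* Finitely many integers are treated at once as the coefficients of a single polynomial. *)
  have fA : Poly [seq x <- xs | x \in Aint] \is a polyOver Aint.
    by apply/polyOverP=> i; rewrite coef_Poly; have [ltix|/(nth_default 0)->] :=
      ltnP i (size [seq x <- xs | x \in Aint]); rewrite ?rpred0 //;
      have := mem_nth 0 ltix; rewrite mem_filter => /andP[].
  have [t Dt tP] := inertia_lift_finite Pp inert_s fA.
  exists t => x xxs; split=> [xA|->]; last by exists t.
  have xf : x \in [seq x <- xs | x \in Aint] by rewrite mem_filter xA.
  by have := tP (index x [seq x <- xs | x \in Aint]); rewrite coef_Poly nth_index.
have [_ /(_ erefl)[u Du Dtz]] := tQ z.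
have tx0 : act t x0 = x0 by apply: (unram prp Pp) => x; have [Px _] := tQ x.
case: sx0; rewrite -Du -[RHS]tx0 (@act_comp u (GQcomp (GQinv u) t) t) => [|x]; last first.
  by rewrite /= algC_invautK.
by rewrite (@act_cont (GQcomp (GQinv u) t)) //; apply: fixX; rewrite /= Dtz algC_autK.
Qed.

End Unramified.

(** * Minkowski's theorem on linear forms *)

Lemma int_unit_absz (d : int) : d \is a GRing.unit -> `|d|%N = 1%N.
Proof. by case/orP=> /eqP->. Qed.

(** Pigeonhole: the box of vectors with entries in [0, q) has more points than the |det M| classes
    modulo the lattice spanned by the columns of M, so two of them differ by some M v. The Smith
    form makes the quotient explicit, [key] being the class of a box point. *)
Lemma int_minkowski (n : nat) (M : 'M[int]_n) (q : nat) :
    \det M != 0 -> (`|\det M| < q ^ n)%N ->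
  exists2 v : 'cV[int]_n, v != 0 & forall i, (`|((M *m v) i 0)%R| < q)%N.
Proof.
have [L uL [R uR [d _ DM]]] := int_Smith_normal_form M.
set D := \matrix_(i, j) _ in DM.
have DD : D = diag_mx (\row_i d`_i) by apply/matrixP=> i j; rewrite !mxE.
have detM : `|\det M|%N = (\prod_(i < n) `|(d`_i)%R|)%N.
  have aU (U : 'M[int]_n) : U \in unitmx -> `|\det U|%N = 1%N.
    by rewrite unitmxE => /int_unit_absz.
  rewrite DM !det_mulmx !abszM (aU L) // (aU R) // mul1n muln1 DD det_diag.
  have absz_prod (I : Type) (r : seq I) (F : I -> int) :
      absz (\prod_(i <- r) F i)%R = (\prod_(i <- r) absz (F i))%N.
    exact: (big_morph absz abszM (erefl _)).
  by rewrite absz_prod; apply: eq_bigr => i _; rewrite mxE.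
rewrite -absz_gt0 detM => d_gt0 lt_d_q.
have di_gt0 (i : 'I_n) : (0 < `|(d`_i)%R|)%N.
  by move: d_gt0; rewrite (bigD1 i) //= muln_gt0 => /andP[].
pose box (f : {ffun 'I_n -> 'I_q}) : 'cV[int]_n := \col_i (f i : nat)%:Z.
have modP (x : int) (i : 'I_n) : (`|(x %% (d`_i)%R)%Z| < `|(d`_i)%R|)%N.
  by rewrite -ltz_nat gez0_abs ?modz_ge0 ?ltz_mod // -absz_gt0.
pose key (f : {ffun 'I_n -> 'I_q}) : {dffun forall i : 'I_n, 'I_(`|(d`_i)%R|%N)} :=
  [ffun i => Ordinal (modP ((invmx L *m box f) i 0) i)].
have /injectivePn[f [g neq_fg eq_key]] : ~~ injectiveb key.
  apply: contraL lt_d_q => /injectiveP/leq_card.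
  rewrite card_ffun card_dep_ffun !card_ord -leqNgt foldrE big_image /=.
  by under eq_bigr do rewrite card_ord.
have keyE i : exists w : int, (invmx L *m (box f - box g)) i 0 = d`_i * w.
  have : ((d`_i)%R %| ((invmx L *m (box f - box g)) i 0)%R)%Z.
    have /ffunP/(_ i) := eq_key; rewrite !ffunE => /(congr1 val) /= /(congr1 Posz).
    rewrite !gez0_abs ?modz_ge0 -?absz_gt0 // mulmxBr !mxE => /eqP.
    by rewrite eqz_mod_dvd.
  by case/dvdzP=> w ->; exists w; rewrite mulrC.
have [w Dw] := fin_all_exists keyE.
pose W := \col_i w i.
have DW : invmx L *m (box f - box g) = D *m W.
  apply/matrixP=> i j; rewrite ord1 Dw DD mul_diag_mx !mxE //.
have MW : M *m (invmx R *m W) = box f - box g.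
  by rewrite DM mulmxA mulmxK // -mulmxA -DW mulmxA mulmxV // mul1mx.
exists (invmx R *m W) => [|i].
  apply: contraNneq neq_fg => W0; apply/eqP/ffunP=> i; apply/val_inj.
  move: MW; rewrite W0 mulmx0 => /esym/eqP; rewrite subr_eq0 => /eqP/matrixP/(_ i 0).
  by rewrite !mxE => -[].
rewrite MW !mxE; have := ltn_ord (f i); have := ltn_ord (g i).
move: (f i : nat) (g i : nat) => a b ltb lta.
by lia.
Qed.

(** * Limits of sequences in [algC] *)

Definition tends (u : nat -> algC) (l : algC) : Prop :=
  forall e : algC, 0 < e -> exists N, forall q, (N <= q)%N -> `|u q - l| <= e.

Lemma tends_const l : tends (fun=> l) l.
Proof. by move=> e e0; exists 0%N => q _; rewrite subrr normr0 ltW. Qed.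

Lemma tendsD u v l m : tends u l -> tends v m -> tends (fun q => u q + v q) (l + m).
Proof.
move=> ul vm e e0; have e2 : 0 < e / 2%:R by rewrite divr_gt0 ?ltr0n.
have [N NP] := ul _ e2; have [M MP] := vm _ e2.
exists (maxn N M) => q; rewrite geq_max => /andP[/NP uq /MP vq].
rewrite opprD addrACA (le_trans (ler_normD _ _)) // [e]splitr; exact: lerD.
Qed.

Lemma tendsM u v l m : tends u l -> tends v m -> tends (fun q => u q * v q) (l * m).
Proof.
move=> ul vm e e0; pose K := `|l| + `|m| + 1.
have K0 : 0 < K by rewrite ltr_wpDl ?addr_ge0.
(* This choice gives both e1 <= 1, which absorbs the quadratic term, and e1 * K <= e. *)
pose e1 := e / (K + e); have Ke : 0 < K + e by rewrite addr_gt0.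
have e10 : 0 < e1 by rewrite divr_gt0.
have e11 : e1 <= 1 by rewrite ler_pdivrMr // mul1r lerDr ltW.
have [N NP] := ul _ e10; have [M MP] := vm _ e10.
exists (maxn N M) => q; rewrite geq_max => /andP[/NP uq /MP vq].
have -> : u q * v q - l * m = (u q - l) * (v q - m) + (l * (v q - m) + m * (u q - l)). by ring.
apply: (@le_trans _ _ (e1 * K)); last first.
  rewrite mulrAC ler_pdivrMr // ler_pM2l // lerDl ltW //.
apply: le_trans (ler_normD _ _) _; rewrite /K [leRHS]mulrDr mulr1 [leRHS]addrC lerD //.
  by rewrite normrM -[leRHS]mulr1 ler_pM // (le_trans vq).
apply: le_trans (ler_normD _ _) _; rewrite !normrM [leRHS]mulrDr.
by rewrite lerD // mulrC ler_wpM2r.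
Qed.

Lemma tends_sum (I : Type) (r : seq I) (F : I -> nat -> algC) (G : I -> algC) :
  (forall i, tends (F i) (G i)) -> tends (fun q => \sum_(i <- r) F i q) (\sum_(i <- r) G i).
Proof.
move=> FG; elim: r => [|i r IHr].
  by move=> e e0; exists 0%N => q _; rewrite !big_nil subrr normr0 ltW.
move=> e /(tendsD (FG i) IHr)[N NP]; exists N => q /NP.
by rewrite !big_cons.
Qed.

Lemma tends_prod (I : Type) (r : seq I) (F : I -> nat -> algC) (G : I -> algC) :
  (forall i, tends (F i) (G i)) -> tends (fun q => \prod_(i <- r) F i q) (\prod_(i <- r) G i).
Proof.
move=> FG; elim: r => [|i r IHr].
  by move=> e e0; exists 0%N => q _; rewrite !big_nil subrr normr0 ltW.
move=> e /(tendsM (FG i) IHr)[N NP]; exists N => q /NP.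
by rewrite !big_cons.
Qed.

Lemma tends_det n (F : nat -> 'M[algC]_n) (G : 'M[algC]_n) :
  (forall i j, tends (fun q => F q i j) (G i j)) -> tends (fun q => \det (F q)) (\det G).
Proof.
move=> FG; apply: tends_sum => s; apply: tendsM; first exact: tends_const.
by apply: tends_prod => i.
Qed.

Lemma archi_nat (x : algC) : 0 <= x -> exists N, forall q, (N <= q)%N -> x <= q%:R.
Proof.
move=> x0; exists (Num.bound x) => q leNq; apply: (@le_trans _ _ (Num.bound x)%:R).
  by rewrite ltW // archi_boundP.
by rewrite ler_nat.
Qed.

Lemma le_norm_mulmx_col m n (A : 'M[algC]_(m, n)) (v : 'cV[algC]_n) (a : algC) :
    (forall i j, `|A i j| <= a) ->
  forall i, `|(A *m v) i 0| <= a * \sum_j `|v j 0|.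
Proof.
move=> leA i; rewrite mxE (le_trans (ler_norm_sum _ _ _)) // mulr_sumr.
by apply: ler_sum => j _; rewrite normrM ler_wpM2r.
Qed.

(** For large q, Y is approximated by M/q with M the integer part of q Y, and [int_minkowski]
    applies to M. The error on Y v is at most B/q, where B is the sum of the |v_j|; since Y is
    invertible, B is bounded independently of q. *)
Lemma minkowski_approx (n : nat) (Y : 'M[algC]_n.+1) (e : algC) :
    (forall i j, Y i j \is Num.real) -> \det Y != 0 -> `|\det Y| < 1 -> 0 < e ->
  exists2 v : 'cV[int]_n.+1, v != 0 &
    forall i, `|(Y *m map_mx intr v) i 0| <= 1 + e.
Proof.
move=> Yreal detY0 detY1 e0.
pose M (q : nat) : 'M[int]_n.+1 := \matrix_(i, j) Num.floor (q%:R * Y i j).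
have MY q i j : `|(M q i j)%:~R - q%:R * Y i j| <= 1.
  have := real_floor_itv (realM (realn _ q) (Yreal i j)); rewrite mxE distrC.
  move: (Num.floor _) => z /andP[lez ltz]; rewrite ger0_norm ?subr_ge0 //.
  by move: ltz; rewrite intrD lerBlDl => /ltW.
have [K K0 KP] : exists2 K : algC, 0 <= K & forall i j, `|invmx Y i j| <= K.
  exists (\sum_i \sum_j `|invmx Y i j|); first by rewrite sumr_ge0 // => i _; rewrite sumr_ge0.
  move=> i j; rewrite (bigD1 i) //= (bigD1 j) //= -addrA lerDl.
  by rewrite addr_ge0 ?sumr_ge0 // => k _; rewrite sumr_ge0.
have detF_tends : tends (fun q => \det (q%:R^-1 *: map_mx intr (M q) : 'M[algC]_n.+1)) (\det Y).
  apply: tends_det => i j e1 e10.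
  have [N NP] := archi_nat (ltW (divr_gt0 (@ltr01 algC) e10)).
  exists (maxn 1 N) => q; rewrite geq_max => /andP[q0 /NP leq].
  have qC : 0 < q%:R :> algC by rewrite ltr0n.
  have -> : (q%:R^-1 *: map_mx intr (M q)) i j - Y i j = q%:R^-1 * ((M q i j)%:~R - q%:R * Y i j).
    by rewrite mulrBr mulKf ?gt_eqF // !mxE.
  rewrite normrM normfV normr_nat ler_pdivrMl // (le_trans (MY q i j)) //.
  by rewrite -ler_pdivrMr.
(* Inverting Y gives B <= C (1 + B/q). Then q >= 2C implies B <= 2C, and q >= 2C/e makes the error
   at most e. *)
pose C := n.+1%:R * (n.+1%:R * K); have C0 : 0 <= C by rewrite !mulr_ge0 ?ler0n.
have d0 : 0 < `|\det Y| / 2%:R by rewrite divr_gt0 ?ltr0n // normr_gt0.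
have d1 : 0 < (1 - `|\det Y|) / 2%:R by rewrite divr_gt0 ?ltr0n // subr_gt0.
have [N1 N1P] := detF_tends _ d0; have [N2 N2P] := detF_tends _ d1.
have [N3 N3P] := archi_nat (mulr_ge0 (ler0n _ 2) C0).
have [N4 N4P] := archi_nat (divr_ge0 (mulr_ge0 (ler0n _ 2) C0) (ltW e0)).
pose q := maxn 1 (maxn (maxn N1 N2) (maxn N3 N4)).
have : (q <= q)%N by []; rewrite {1}/q !geq_max.
case/andP=> q0 /andP[/andP[/N1P q1 /N2P q2] /andP[/N3P q3 /N4P q4]].
have qC : 0 < q%:R :> algC by rewrite ltr0n.
move: q1 q2; rewrite detZ det_map_mx; set u := _ * _ => q1 q2.
have u0 : u != 0.
  apply/eqP=> u0; move: q1; rewrite u0 sub0r normrN ler_pdivlMr ?ltr0n // ger_pMr ?normr_gt0 //.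
  by rewrite lern1.
have u1 : `|u| < 1.
  rewrite -[u](subrK (\det Y)) (le_lt_trans (ler_normD _ _)) // -ltrBrDr.
  rewrite (le_lt_trans q2) // ltr_pdivrMr ?ltr0n // ltr_pMr ?subr_gt0 //.
  by rewrite ltr1n.
have detM0 : \det (M q) != 0.
  by apply: contraNneq u0 => D0; rewrite /u D0 mulr0.
have detM1 : (`|\det (M q)| < q ^ n.+1)%N.
  move: u1; rewrite /u normrM exprVn normfV normrX normr_nat ltr_pdivrMl ?exprn_gt0 // mulr1.
  by rewrite -intr_norm -abszE -pmulrn -natrX ltr_nat.
have [v v0 vP] := int_minkowski detM0 detM1.
exists v => // i; set x : 'cV[algC]__ := map_mx intr v.
pose B := \sum_j `|x j 0|; have B0 : 0 <= B by rewrite sumr_ge0.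
have leYx k : `|(Y *m x) k 0| <= 1 + B / q%:R.
  have : `|((map_mx intr (M q) - q%:R *: Y) *m x) k 0| <= 1 * B.
    by apply: le_norm_mulmx_col => i' j; have := MY q i' j; rewrite !mxE.
  rewrite mul1r mulmxBl -scalemxAl -map_mxM => le1.
  have le2 : `|(map_mx intr (M q *m v)) k 0| <= q%:R :> algC.
    by rewrite mxE -intr_norm -abszE -pmulrn ler_nat ltnW // vP.
  rewrite -(ler_pM2l qC) mulrDr mulr1 mulrCA mulfV ?gt_eqF // mulr1.
  rewrite -[q%:R in leLHS]ger0_norm ?ler0n // -normrM.
  have -> : q%:R * (Y *m x) k 0 = (map_mx intr (M q *m v)) k 0 -
      (map_mx intr (M q *m v) - q%:R *: (Y *m x)) k 0.
    by rewrite !mxE opprB addrC subrK.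
  by rewrite (le_trans (ler_normB _ _)) // lerD.
have leB : B <= 2%:R * C.
  have Bq : B <= C * (1 + B / q%:R).
    have lex j : `|x j 0| <= n.+1%:R * K * (1 + B / q%:R).
      have Dx : x = invmx Y *m (Y *m x) by rewrite mulKmx // unitmxE unitfE.
      rewrite [in leLHS]Dx (le_trans (le_norm_mulmx_col (Y *m x) KP _)) //.
      rewrite -mulrA mulrCA ler_wpM2l // (le_trans (ler_sum _ (fun k _ => leYx k))) //.
      by rewrite sumr_const card_ord mulr_natl.
    rewrite (le_trans (ler_sum _ (fun k _ => lex k))) //.
    by rewrite sumr_const card_ord -[leLHS]mulr_natl /C -!mulrA.
  have CB : 2%:R * (C * (B / q%:R)) <= B.
    have -> : 2%:R * (C * (B / q%:R)) = B * (2%:R * C) / q%:R by ring.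
    by rewrite ler_pdivrMr // ler_wpM2l.
  have : 2%:R * B <= 2%:R * C + B.
    rewrite (le_trans (ler_wpM2l (ler0n _ 2) Bq)) // mulrDr mulr1 mulrDr lerD2l //.
  by rewrite mulrDl mul1r lerD2r.
rewrite (le_trans (leYx i)) // lerD2l ler_pdivrMr // (le_trans leB) //.
by rewrite [leRHS]mulrC -ler_pdivrMr.
Qed.

Lemma gt1_gap (r : seq algC) :
  exists2 t : algC, 1 < t <= 2%:R & forall x, x \in r -> 1 < x -> t < x.
Proof.
elim: r => [|x r [t /andP[t1 t2] tP]]; first by exists 2%:R; rewrite // ltr1n lexx.
have [x1|nx1] := boolP (1 < x); last first.
  exists t; rewrite ?t1 // => y; rewrite inE => /predU1P[-> y1|/tP//].
  by rewrite y1 in nx1.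
have real_gt1 (y : algC) : 1 < y -> y \is Num.real by move=> /(lt_trans ltr01)/gtr0_real.
have [tx|xt] := real_ltP (real_gt1 t t1) (real_gt1 x x1).
  exists t; rewrite ?t1 // => y; rewrite inE => /predU1P[->|/tP] //.
have [lt1m ltmx] := (midf_lt x1).
exists ((1 + x) / 2%:R); rewrite ?lt1m /= ?(le_trans (ltW ltmx)) ?(le_trans xt) //.
move=> y; rewrite inE => /predU1P[->|/tP lty /lty] //.
by apply/le_lt_trans/(le_trans _ xt)/ltW.
Qed.

(** Row i0 is stretched and the others shrunk slightly, making the determinant less than 1. The
    other forms are then at most some t > 1. Only finitely many integer vectors have all forms at
    most 2, so t can be taken below every value greater than 1 that they attain; the bound t then
    improves to 1. *)
Lemma minkowski_strict (n : nat) (Y : 'M[algC]_n.+1) (i0 : 'I_n.+1) :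
    (0 < n)%N -> (forall i j, Y i j \is Num.real) -> `|\det Y| = 1 ->
  exists2 v : 'cV[int]_n.+1, v != 0 &
    (forall i, `|(Y *m map_mx intr v) i 0| <= 1) /\
    `|(Y *m map_mx intr v) i0 0| < 1.
Proof.
case: n Y i0 => // n Y i0 _ Yreal detY.
have detY0 : \det Y != 0 by rewrite -normr_eq0 detY oner_eq0.
have [K K0 KP] : exists2 K : algC, 0 <= K & forall i j, `|invmx Y i j| <= K.
  exists (\sum_i \sum_j `|invmx Y i j|); first by rewrite sumr_ge0 // => i _; rewrite sumr_ge0.
  move=> i j; rewrite (bigD1 i) //= (bigD1 j) //= -addrA lerDl.
  by rewrite addr_ge0 ?sumr_ge0 // => k _; rewrite sumr_ge0.
have [N NP] : exists N : nat, forall v : 'cV[int]_n.+2,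
    (forall i, `|(Y *m map_mx intr v) i 0| <= 2%:R) -> forall j, (absz (v j 0)%R <= N)%N.
  have C0 : 0 <= K * (n.+2%:R * 2%:R) by rewrite !mulr_ge0 ?ler0n.
  have [N /(_ N (leqnn N)) NP] := archi_nat C0.
  exists N => v vP j; rewrite -(ler_nat algC); apply: le_trans NP.
  have -> : (absz (v j 0))%:R = `|(map_mx intr v : 'cV[algC]_n.+2) j 0|.
    by rewrite mxE -intr_norm -abszE -pmulrn.
  have Dx : map_mx intr v = invmx Y *m (Y *m map_mx intr v) :> 'cV[algC]_n.+2.
    by rewrite mulKmx // unitmxE unitfE.
  rewrite Dx (le_trans (le_norm_mulmx_col _ KP _)) // ler_wpM2l //.
  rewrite (le_trans (ler_sum _ (fun k _ => vP k))) //.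
  by rewrite sumr_const card_ord mulr_natl.
pose w (f : {ffun 'I_n.+2 -> 'I_(N + N).+1}) : 'cV[int]_n.+2 := \col_i ((f i)%:Z - N%:Z).
have [t /andP[t1 t2] tP] := gt1_gap [seq `|(Y *m map_mx intr (w f)) i 0| |
  f <- enum {ffun 'I_n.+2 -> 'I_(N + N).+1}, i <- enum 'I_n.+2].
(* With 1 + e = d in [minkowski_approx], form i0 is at most d / d^2 < 1 and the others are at most d
   * d^3 = t. *)
pose d := 4.-root t.
have d4 : d ^+ 4 = t by rewrite rootCK.
have d1 : 1 < d.
  rewrite -(ltr_pXn2r (_ : (0 < 4)%N)) ?nnegrE ?ler01 ?rootC_ge0 ?(le_trans _ (ltW t1)) //.
  by rewrite d4 expr1n.
have d0 : 0 < d by apply: lt_trans d1.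
(* The product of these factors is < 1, as needed to apply minkowski_approx. *)
pose c := \row_(i < n.+2) (if i == i0 then d ^+ 2 else d ^- 3).
have cY v i : (diag_mx c *m Y *m v) i (0 : 'I_1) = c 0 i * (Y *m v) i 0.
  by rewrite -mulmxA mul_diag_mx mxE.
have dcY : \det (diag_mx c *m Y) = d ^+ 2 * d ^- (3 * n.+1) * \det Y.
  rewrite det_mulmx det_diag (bigD1 i0) //= mxE eqxx; congr (_ * _ * _).
  rewrite (eq_bigr (fun=> d ^- 3)) => [|i /negPf ni]; last by rewrite mxE ni.
  by rewrite prodr_const cardC1 card_ord -exprVn -exprM -exprVn.
have [||||v v0 vP] := @minkowski_approx _ (diag_mx c *m Y) (d - 1).
- move=> i j; rewrite mul_diag_mx !mxE realM //.
  by case: ifP => _; rewrite ?realV ?realX ?gtr0_real.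
- by rewrite dcY !mulf_neq0 ?invr_eq0 ?expf_neq0 // gt_eqF.
- rewrite dcY !normrM detY mulr1 normfV !normrX gtr0_norm //.
  by rewrite ltr_pdivrMr ?exprn_gt0 // mul1r -expr2 ltr_eXn2l // mulnS.
- by rewrite subr_gt0.
have leYi i : i != i0 -> `|(Y *m map_mx intr v) i 0| <= t.
  move=> /negPf ni; have := vP i; rewrite cY mxE ni normrM gtr0_norm ?invr_gt0 ?exprn_gt0 //.
  by rewrite ler_pdivrMl ?exprn_gt0 // addrC subrK -exprSr d4.
have ltY0 : `|(Y *m map_mx intr v) i0 0| < 1.
  have := vP i0; rewrite cY mxE eqxx normrM gtr0_norm ?exprn_gt0 //.
  rewrite addrC subrK expr2 -mulrA -{3}[d]mulr1 ler_pM2l // mulrC -ler_pdivlMr // => le1.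
  by rewrite (le_lt_trans le1) // mul1r invf_lt1.
exists v => //; split=> // i; have [-> | ni] := eqVneq i i0; first exact: ltW.
rewrite real_leNgt ?normr_real ?real1 //; apply/negP => lt1.
have vN : forall j, (absz (v j 0)%R <= N)%N.
  apply: NP => j; have [->|nj] := eqVneq j i0; first by rewrite ltW // (lt_trans ltY0) ?ltr1n.
  exact: le_trans (leYi j nj) t2.
have [f Df] : exists f, v = w f.
  have lt_f j : (absz (v j 0 + N%:Z)%R < (N + N).+1)%N.
    by have := vN j; lia.
  exists [ffun j => Ordinal (lt_f j)]; apply/matrixP => j k; rewrite ord1 !mxE ffunE /=.
  by have := vN j; lia.
have := leYi i ni; rewrite real_leNgt ?normr_real ?(gtr0_real (lt_trans ltr01 t1)) //; case/negP.
apply: tP => //; rewrite Df; apply/allpairsP; exists (f, i).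
by rewrite !mem_enum.
Qed.

(** * Q has no unramified extension *)

Local Notation mxC := (map_mx (intr : int -> algC)).

(* In a Smith basis of the Gram matrix T of the columns of B, the columns with *)
(* elementary divisor 0 vanish, and the n others are a basis.                  *)
Lemma lattice_basis (n m : nat) (A B : 'M[algC]_(n, m)) (T : 'M[int]_m) :
    A *m B^T = 1%:M -> B^T *m B = mxC T ->
  exists (R1 : 'M[int]_(m, n)) (R2 : 'M[int]_(n, m)), B *m mxC R1 *m mxC R2 = B.
Proof.
move=> AB BB; have [L uL [R uR [d _ DT]]] := int_Smith_normal_form T.
set D := \matrix_(i, j) _ in DT.
have DD : D = diag_mx (\row_i d`_i) by apply/matrixP=> i j; rewrite !mxE.
pose N := B *m mxC (invmx R).
have BN : B^T *m N = mxC (L *m D).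
  by rewrite mulmxA BB -map_mxM DT mulmxK.
have N0 i (k : 'I_m) : d`_k = 0 -> N i k = 0.
  move=> dk; rewrite -[N]mul1mx -AB -mulmxA BN mxE big1 // => j _.
  by rewrite DD mul_mx_diag !mxE dk mulr0 rmorph0 mulr0.
pose S := [set k : 'I_m | d`_k != 0].
pose f (s : 'I_#|S|) : 'I_m := enum_val s.
have DB : B = N *m mxC R by rewrite -mulmxA -map_mxM mulVmx // map_mx1 mulmx1.
have NE : colsub f N *m rowsub f (mxC R) = B.
  apply/matrixP=> i j; rewrite [in RHS]DB !mxE [RHS](bigID (mem S)) /= [X in _ + X]big1 ?addr0.
    by rewrite [RHS]big_enum_val; apply: eq_bigr => s _; rewrite !mxE.
  by move=> k; rewrite inE negbK => /eqP dk; rewrite N0 ?mul0r.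
(* #|S| = n: an invertible diagonal matrix of size #|S| factors through dimension n, and conversely
   B, of rank n as A B^T = 1, factors through dimension #|S|. *)
have leSn : (#|S| <= n)%N.
  have DU : rowsub f (mxC (invmx L) *m B^T) *m colsub f N = diag_mx (\row_s (d`_(f s))%:~R).
    rewrite (mulmx_colsub f _ N) mul_rowsub_mx -(mulmxA _ B^T) BN -map_mxM mulKmx // DD.
    apply/matrixP=> i j; rewrite !mxE (inj_eq enum_val_inj).
    by case: eqP => [->|]; rewrite ?rmorph0.
  have : \rank (diag_mx (\row_s (d`_(f s))%:~R : 'rV[algC]_#|S|)) = #|S|.
    apply: mxrank_unit; rewrite unitmxE unitfE det_diag; apply/prodf_neq0 => s _.
    by rewrite mxE intr_eq0; have := enum_valP s; rewrite inE.
  by rewrite -DU => <-; apply: leq_trans (mxrankM_maxr _ _) (rank_leq_row _).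
have lenS : (n <= #|S|)%N.
  rewrite -[X in (X <= _)%N](mxrank1 algC) -AB.
  rewrite (leq_trans (mxrankM_maxr _ _)) // mxrank_tr -NE.
  exact: leq_trans (mxrankM_maxl _ _) (rank_leq_col _).
have : exists (R1 : 'M[int]_(m, #|S|)) (R2 : 'M[int]_(#|S|, m)), B *m mxC R1 *m mxC R2 = B.
  exists (colsub f (invmx R)), (rowsub f R).
  by rewrite -[RHS]NE !map_mxsub mulmx_colsub.
by have -> : #|S| = n by apply/anti_leq; rewrite leSn.
Qed.

(** * Dual families and embeddings of the fixed field *)

Section CosetRepresentatives.
Variables (T : finType) (act : GQ -> T -> T) (x0 : T) (X : seq algC).
Hypothesis act_comp : forall s t u : GQ,
  (forall x, u x = s (t x)) -> forall p, act u p = act s (act t p).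
Hypothesis act_cont : forall s : GQ, {in X, s =1 id} -> forall p, act s p = p.
Hypothesis unram : forall p P, prime p -> Defs.prime_above p P ->
  forall s : GQ, inertia P s -> act s x0 = x0.

Lemma stab_int_sum (I : Type) (r : seq I) (F : I -> algC) :
  (forall i, stab_int act x0 (F i)) -> stab_int act x0 (\sum_(i <- r) F i).
Proof.
move=> FP; split=> [|h Hh]; first by rewrite rpred_sum // => i _; case: (FP i).
by rewrite rmorph_sum; apply: eq_bigr => i _; case: (FP i) => _ ->.
Qed.

(** By induction on the points to be killed: expressions sum a s(b) are closed under products, and
    each point p = s0 x0 distinct from x0 contributes a factor that is 1 on the stabilizer and 0 on
    the coset of s0. *)
Lemma dual_pairs : exists2 ab : seq (algC * algC),
  forall c, c \in ab -> c.1 \in Aint /\ stab_int act x0 c.2 &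
  forall s : GQ, \sum_(c <- ab) c.1 * s c.2 = (act s x0 == x0)%:R.
Proof.
suffices /(_ [seq p <- enum T | p != x0])[|ab abP [ab1 ab0]] :
  forall l : seq T, x0 \notin l -> exists2 ab : seq (algC * algC),
    forall c, c \in ab -> c.1 \in Aint /\ stab_int act x0 c.2 &
    (forall s : GQ, act s x0 = x0 -> \sum_(c <- ab) c.1 * s c.2 = 1) /\
    (forall s : GQ, act s x0 \in l -> \sum_(c <- ab) c.1 * s c.2 = 0).
- by rewrite mem_filter eqxx.
- exists ab => // s; have [sx|sx] := eqVneq; first exact: ab1.
  by apply: ab0; rewrite mem_filter sx mem_enum.
elim=> [_|p l IHl].
  exists [:: (1, 1)] => [c|].
    by rewrite inE => /eqP-> /=; rewrite rpred1; case: (stab_int_subring act x0).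
  by split=> // s _; rewrite big_seq1 /= rmorph1 mulr1.
rewrite inE negb_or eq_sym => /andP[px /IHl[ab abP [ab1 ab0]]].
have [[s0 Ds0]|nop] := pselect (exists s : GQ, act s x0 = p); last first.
  exists ab => //; split=> // s; rewrite inE => /predU1P[sp|]; last exact: ab0.
  by case: nop; exists s.
have [|cs csP cs1] := @unit_ideal T act x0 X act_comp act_cont unram s0.
  by rewrite Ds0; apply/eqP.
(* The factor 1 - sum c.1 (s c.2 - c.2), rewritten in the form sum a s(b). *)
pose ds := (1 + \sum_(c <- cs) c.1 * c.2, 1) :: [seq (- c.1, c.2) | c <- cs].
have dsP c : c \in ds -> c.1 \in Aint /\ stab_int act x0 c.2.
  rewrite inE => /predU1P[->|/mapP[{}c /csP[c1 c2] ->]] /=; last by rewrite rpredN.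
  split; last by case: (stab_int_subring act x0).
  by rewrite rpredD ?rpred1 // big_seq rpred_sum // => d /csP[d1 [d2 _]]; rewrite rpredM.
have dsE (s : GQ) : \sum_(c <- ds) c.1 * s c.2 = 1 - \sum_(c <- cs) c.1 * (s c.2 - c.2).
  rewrite big_cons big_map /= rmorph1 mulr1 -addrA -sumrN -big_split /=.
  by congr (1 + _); apply: eq_bigr => c _; ring.
exists [seq (c.1 * d.1, c.2 * d.2) | c <- ab, d <- ds].
  move=> _ /allpairsP[[c d] /= [/abP[c1 c2] /dsP[d1 d2] ->]] /=; rewrite rpredM //.
  by split=> //; case: (stab_int_subring act x0) => _ M _; apply: M.
have prodE (s : GQ) : \sum_(c <- [seq (c.1 * d.1, c.2 * d.2) | c <- ab, d <- ds]) c.1 * s c.2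
    = (\sum_(c <- ab) c.1 * s c.2) * (\sum_(c <- ds) c.1 * s c.2).
  rewrite big_allpairs_dep mulr_suml; apply: eq_bigr => c _.
  by rewrite mulr_sumr; apply: eq_bigr => d _ /=; rewrite rmorphM mulrACA.
split=> s; rewrite prodE dsE.
  move=> sx; rewrite ab1 // mul1r big_seq big1 ?subr0 // => c /csP[_ [_ fixc]].
  by rewrite fixc // subrr mulr0.
rewrite inE => /predU1P[sp|/ab0->]; last by rewrite mul0r.
suffices -> : \sum_(c <- cs) c.1 * (s c.2 - c.2) = 1 by rewrite subrr mulr0.
rewrite -{}cs1; apply: eq_big_seq => c /csP[_ c2].
by rewrite (stab_int_coset act_comp act_cont _ c2 (t := s0)) // sp Ds0.
Qed.

Lemma coset_reps : exists n (r : 'I_n.+1 -> GQ) (pi : GQ -> 'S_n.+1),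
  [/\ act (r ord0) x0 = x0, forall s : GQ, exists i, act s x0 = act (r i) x0,
      forall i j, act (r i) x0 = act (r j) x0 -> i = j &
      forall (t : GQ) i, act (r (pi t i)) x0 = act t (act (r i) x0)].
Proof.
pose O := [seq p <- enum T | (p != x0) && `[< exists s : GQ, act s x0 = p >]].
pose e (i : 'I_(size O).+1) := nth x0 (x0 :: O) i.
have uO : uniq (x0 :: O) by rewrite /= mem_filter eqxx filter_uniq ?enum_uniq.
have eO i : e i \in x0 :: O by rewrite mem_nth.
have actO i : exists s : GQ, act s x0 = e i.
  have := eO i; rewrite inE => /predU1P[->|]; first by exists idfun; rewrite act_cont.
  by rewrite mem_filter => /andP[/andP[_ /asboolP]].
have memO (s : GQ) : act s x0 \in x0 :: O.
  rewrite inE mem_filter mem_enum andbT; case: eqP => //= _.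
  by apply/asboolP; exists s.
have idxO p : p \in x0 :: O -> exists i, e i = p.
  move=> pO; have lt_p : (index p (x0 :: O) < (size O).+1)%N.
    by rewrite -[X in (_ < X)%N]/(size (x0 :: O)) index_mem.
  by exists (Ordinal lt_p); rewrite /e nth_index.
have e_inj : injective e.
  by move=> i j /eqP; rewrite nth_uniq ?ltn_ord // => /eqP/val_inj.
have [r rP] := boolp.choice actO.
have piP (t : GQ) i : exists j, e j = act t (e i).
  apply: idxO; have [s <-] := actO i.
  by rewrite -(@act_comp t s (GQcomp t s)) // memO.
have act_inj (t : GQ) : injective (act t).
  move=> p q /(congr1 (act (GQinv t))).
  rewrite -!(@act_comp (GQinv t) t (GQcomp (GQinv t) t)) // !act_cont // => x _;
    by rewrite /= algC_autK.
have exPi (t : GQ) : exists g : 'S_(size O).+1, forall i, e (g i) = act t (e i).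
  have [g gP] := boolp.choice (piP t).
  have g_inj : injective g.
    by move=> i j /(congr1 e); rewrite !gP => /act_inj/e_inj.
  by exists (perm g_inj) => i; rewrite permE gP.
have [pi piE] := boolp.choice exPi.
exists (size O), r, pi; split.
- by rewrite rP.
- by move=> s; have [i Di] := idxO _ (memO s); exists i; rewrite rP.
- by move=> i j; rewrite !rP => /e_inj.
- by move=> t i; rewrite !rP piE.
Qed.

End CosetRepresentatives.

Definition GQconj : GQ := Num.conj.

Lemma GQ_fixed_int (x : algC) : x \in Aint -> (forall s : GQ, s x = x) -> x \in Num.int.
Proof. by move=> xA /GQ_fixed_rat xQ; apply: Cint_rat_Aint. Qed.

Lemma det_Aint n (M : 'M[algC]_n) : (forall i j, M i j \in Aint) -> \det M \in Aint.
Proof.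
move=> MA; rewrite rpred_sum // => s _; rewrite rpredM ?rpredX ?rpredN1 //.
by rewrite rpred_prod.
Qed.

(** * A unimodular matrix of conjugates forces degree one *)

Section UnimodularBasis.
Variables (T : finType) (act : GQ -> T -> T) (x0 : T) (X : seq algC).
Hypothesis act_comp : forall s t u : GQ,
  (forall x, u x = s (t x)) -> forall p, act u p = act s (act t p).
Hypothesis act_cont : forall s : GQ, {in X, s =1 id} -> forall p, act s p = p.
Hypothesis unram : forall p P, prime p -> Defs.prime_above p P ->
  forall s : GQ, inertia P s -> act s x0 = x0.

Variables (n : nat) (r : 'I_n.+1 -> GQ) (pi : GQ -> 'S_n.+1).
Hypothesis r_inj : forall i j, act (r i) x0 = act (r j) x0 -> i = j.
Hypothesis piE : forall (t : GQ) i, act (r (pi t i)) x0 = act t (act (r i) x0).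

Let conj_coset (t : GQ) i x : stab_int act x0 x -> t (r i x) = r (pi t i) x.
Proof.
move=> xP; rewrite -[LHS]/(GQcomp t (r i) x).
by apply: (stab_int_coset act_comp act_cont _ xP); rewrite (@act_comp t (r i)).
Qed.

Lemma coset_norm_int x : stab_int act x0 x -> \prod_i r i x \in Num.int.
Proof.
move=> xP; apply: GQ_fixed_int => [|t].
  by rewrite rpred_prod // => i _; rewrite Aint_aut; case: xP.
rewrite rmorph_prod [RHS](reindex_inj (@perm_inj _ (pi t))).
by apply: eq_bigr => i _; rewrite conj_coset.
Qed.

Lemma coset_trace_int x : stab_int act x0 x -> \sum_i r i x \in Num.int.
Proof.
move=> xP; apply: GQ_fixed_int => [|t].
  by rewrite rpred_sum // => i _; rewrite Aint_aut; case: xP.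
rewrite rmorph_sum [RHS](reindex_inj (@perm_inj _ (pi t))).
by apply: eq_bigr => i _; rewrite conj_coset.
Qed.

(** [dual_pairs] says A B^T = 1 for the matrices of conjugates, and B^T B is integral, being made of
    traces. With R1, R2 from [lattice_basis], M = B R1 and U = A R2^T satisfy U M^T = A (B R1 R2)^T
    = 1. Both determinants are algebraic integers with G_Q-invariant squares, so these squares are
    integers of product 1. *)
Lemma unimodular_basis : exists e : 'I_n.+1 -> algC,
  (forall j, stab_int act x0 (e j)) /\ `|\det (\matrix_(i, j) r i (e j))| = 1.
Proof.
have [ab abP abE] := dual_pairs act_comp act_cont unram.
pose m := size ab; pose c (k : 'I_m) := nth (0, 0) ab k.
have cP k : (c k).1 \in Aint /\ stab_int act x0 (c k).2 by apply: abP; rewrite mem_nth.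
pose A := \matrix_(i < n.+1, k < m) r i (c k).1.
pose B := \matrix_(i < n.+1, k < m) r i (c k).2.
have AB : A *m B^T = 1%:M.
  apply/matrixP=> i j; rewrite !mxE.
  transitivity (r i (\sum_(d <- ab) d.1 * GQcomp (GQinv (r i)) (r j) d.2)).
    rewrite (big_nth (0, 0)) big_mkord rmorph_sum; apply: eq_bigr => k _.
    by rewrite !mxE rmorphM /= algC_invautK.
  rewrite abE rmorph_nat (@act_comp (GQinv (r i)) (r j)) //; congr (nat_of_bool _)%:R.
  apply/eqP/eqP=> [Dx|->].
    apply: r_inj; rewrite -[in LHS]Dx -(@act_comp _ _ (GQcomp (r i) (GQinv (r i)))) //.
    by rewrite act_cont // => x _ /=; rewrite algC_invautK.
  rewrite -(@act_comp _ _ (GQcomp (GQinv (r j)) (r j))) //.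
  by rewrite act_cont // => x _ /=; rewrite algC_autK.
have exT (kl : 'I_m * 'I_m) : exists z : int, (B^T *m B) kl.1 kl.2 = z%:~R.
  apply/intrP; rewrite mxE; under eq_bigr => i _ do rewrite !mxE -rmorphM.
  apply: coset_trace_int; case: (stab_int_subring act x0) => _ M _.
  by apply: M; [case: (cP kl.1)|case: (cP kl.2)].
have [Tz TzE] := boolp.choice exT.
have BB : B^T *m B = mxC (\matrix_(k, l) Tz (k, l)).
  by apply/matrixP=> k l; rewrite (TzE (k, l)) !mxE.
have [R1 [R2 BR]] := lattice_basis AB BB.
pose e j := \sum_k (c k).2 * (R1 k j)%:~R.
have eP j : stab_int act x0 (e j).
  apply: stab_int_sum => k; case: (stab_int_subring act x0) => _ M _.
  apply: M; first by case: (cP k).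
  by split=> [|h _]; rewrite ?Aint_int ?rmorph_int.
exists e; split=> //; set M := \matrix_(i, j) _.
have DM : M = B *m mxC R1.
  apply/matrixP=> i j; rewrite !mxE rmorph_sum; apply: eq_bigr => k _.
  by rewrite !mxE rmorphM rmorph_int.
pose U := A *m (mxC R2)^T.
have UM : \det U * \det M = 1.
  by rewrite -(det_tr M) -det_mulmx -mulmxA -trmx_mul DM BR AB det1.
have MA : \det M \in Aint by apply: det_Aint => i j; rewrite mxE Aint_aut; case: (eP j).
have UA : \det U \in Aint.
  apply: det_Aint => i j; rewrite mxE rpred_sum // => k _; rewrite !mxE rpredM ?Aint_int //.
  by rewrite Aint_aut; case: (cP k).
have M2fix (t : GQ) : t (\det M ^+ 2) = \det M ^+ 2.
  have tM : map_mx t M = perm_mx (pi t) *m M.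
    rewrite -row_permE; apply/matrixP=> i j; rewrite !mxE.
    by rewrite conj_coset.
  by rewrite rmorphXn -det_map_mx tM det_mulmx det_perm exprMn sqrr_sign mul1r.
have M2int : \det M ^+ 2 \in Num.int by apply: GQ_fixed_int => //; rewrite rpredX.
have U2int : \det U ^+ 2 \in Num.int.
  apply: GQ_fixed_int => [|t]; first by rewrite rpredX.
  have DU : \det U ^+ 2 = (\det M ^+ 2)^-1.
    have M2n0 : \det M ^+ 2 != 0.
      rewrite expf_neq0 //; apply: contra_eq_neq UM => ->; by rewrite mulr0 eq_sym oner_eq0.
    by rewrite -[LHS](mulfK M2n0) -exprMn UM expr1n mul1r.
  by rewrite DU fmorphV M2fix.
have UM2 : `|\det U| ^+ 2 * `|\det M| ^+ 2 = 1 by rewrite -exprMn -normrM UM normr1 expr1n.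
have [U0 M0] : \det U != 0 /\ \det M != 0.
  by apply/andP; rewrite -negb_or -mulf_eq0 UM oner_eq0.
have leM : 1 <= `|\det M| ^+ 2 by rewrite -normrX norm_intr_ge1 // expf_neq0.
have leU : 1 <= `|\det U| ^+ 2 by rewrite -normrX norm_intr_ge1 // expf_neq0.
apply/eqP; rewrite -(@pexpr_eq1 _ _ 2) //; apply/eqP/le_anti; rewrite leM andbT.
by rewrite -UM2 ler_peMl // (le_trans ler01).
Qed.

(** With at least two embeddings, [minkowski_strict] yields a nonzero w in O with all conjugates of
    modulus at most 1 and one of modulus less than 1; its norm would be a nonzero integer of modulus
    less than 1. *)
Lemma unimodular_basis_trivial : n = 0%N.
Proof.
have [e [eP]] := unimodular_basis; set M := \matrix_(i, j) _ => detM.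
apply/eqP; rewrite -leqn0 leqNgt; apply/negP => n_gt0.
pose c : 'S_n.+1 := pi GQconj.
have cK i : c (c i) = i.
  apply: r_inj; rewrite !piE -(@act_comp GQconj GQconj (GQcomp GQconj GQconj)) //.
  by rewrite act_cont // => x _ /=; rewrite conjCK.
have rc i x : stab_int act x0 x -> r (c i) x = (r i x)^*.
  by move=> xP; rewrite -conj_coset.
(* Conjugation permutes the coordinates z_i of a vector by c, and           *)
(* y_i = al z_i + be z_(c i) = Re z_i + Im z_i are real coordinates with    *)
(* y_i^2 + y_(c i)^2 = 2 |z_i|^2, obtained by a unitary transformation.     *)
pose al : algC := (1 - 'i) / 2%:R; pose be : algC := (1 + 'i) / 2%:R.
have i2 : 'i * 'i = -1 :> algC by rewrite -expr2 sqrCi.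
have n2 : 2%:R != 0 :> algC by rewrite pnatr_eq0.
have alC : al^* = be by rewrite rmorphM rmorphB /= conjCi rmorph1 opprK fmorphV rmorph_nat.
have beC : be^* = al by rewrite -alC conjCK.
have al2 : al * al + be * be = 0.
  rewrite /al /be; transitivity ((1 + 'i * 'i) / 2%:R : algC); last by rewrite i2 subrr mul0r.
  by field.
have albe : al * be = 1 / 2%:R.
  rewrite /al /be; transitivity ((1 - 'i * 'i) / (2%:R * 2%:R) : algC); first by field.
  by rewrite i2; field.
clearbody al be.
pose P : 'M[algC]_n.+1 := perm_mx c.
have PP : P *m P = 1%:M.
  rewrite -perm_mxM; suffices -> : (c * c)%g = 1%g by rewrite perm_mx1.
  by apply/permP => i; rewrite permM perm1 cK.
pose W := al%:M + be *: P; pose V := be%:M + al *: P.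
have WV : W *m V = 1%:M.
  rewrite mulmxDl !mulmxDr !mul_scalar_mx mul_mx_scalar -scalemxAl -scalemxAr PP !scalerA.
  rewrite addrA -(addrA _ ((al * al) *: P)) -scalerDl al2 scale0r addr0 !scale_scalar_mx mulr1.
  by rewrite (mulrC be) albe -raddfD /= -splitr.
have detW : `|\det W| = 1.
  have VW : V = map_mx GQconj W.
    apply/matrixP=> i j; rewrite !mxE /= rmorphD rmorphM rmorphMn /= alC beC.
    by rewrite rmorph_nat.
  apply/eqP; rewrite -(@pexpr_eq1 _ _ 2) // normCK.
  by rewrite -[(\det W)^*]/(GQconj _) -det_map_mx -VW -det_mulmx WV det1.
pose Y := W *m M.
have YE (z : 'cV[algC]_n.+1) i : (W *m z) i 0 = al * z i 0 + be * z (c i) 0.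
  by rewrite mulmxDl mul_scalar_mx -scalemxAl -row_permE !mxE.
have Yreal i j : Y i j \is Num.real.
  rewrite CrealE /Y mulmxDl mul_scalar_mx -scalemxAl -row_permE !mxE rc //.
  by rewrite rmorphD !rmorphM /= alC beC conjCK addrC.
have detY : `|\det Y| = 1 by rewrite det_mulmx normrM detW detM mulr1.
have [v v0 [vP vlt]] := minkowski_strict ord0 n_gt0 Yreal detY.
pose x : 'cV[algC]_n.+1 := map_mx intr v; pose z := M *m x.
pose w := \sum_j e j * (v j 0)%:~R.
have wP : stab_int act x0 w.
  apply: stab_int_sum => j; case: (stab_int_subring act x0) => _ Mu _.
  by apply: Mu => //; split=> [|h _]; rewrite ?Aint_int ?rmorph_int.
have zE i : z i 0 = r i w.
  rewrite mxE rmorph_sum; apply: eq_bigr => j _.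
  by rewrite !mxE rmorphM rmorph_int.
have yE i : (Y *m x) i 0 = al * r i w + be * (r i w)^*.
  by rewrite -mulmxA -/z YE !zE rc.
have norm_z i : `|r i w| ^+ 2 = (`|(Y *m x) i 0| ^+ 2 + `|(Y *m x) (c i) 0| ^+ 2) / 2%:R.
  have yreal k : `|(Y *m x) k 0| ^+ 2 = (Y *m x) k 0 ^+ 2.
    by rewrite real_normK // yE CrealE rmorphD !rmorphM /= alC beC conjCK addrC.
  rewrite !yreal !yE rc // conjCK normCK.
  set a := r i w; set b := a^*.
  transitivity (((al * al + be * be) * (a * a + b * b) + (al * be) * (4%:R * (a * b))) / 2%:R).
    by rewrite al2 albe mul0r add0r; field.
  by ring.
have le_y i : `|(Y *m x) i 0| ^+ 2 <= 1 by rewrite expr_le1.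
have le_z i : `|r i w| <= 1.
  rewrite -(@expr_le1 _ 2) // norm_z ler_pdivrMr ?ltr0n // mul1r.
  by rewrite (_ : 2%:R = 1 + 1) // lerD.
have lt_z : `|r ord0 w| < 1.
  rewrite -(@expr_lt1 _ 2) // norm_z ltr_pdivrMr ?ltr0n // mul1r.
  by rewrite (_ : 2%:R = 1 + 1) // ltr_leD // expr_lt1.
have w0 : w != 0.
  apply: contraNneq v0 => w0; have z0 : z = 0.
    by apply/matrixP=> i j; rewrite ord1 zE w0 rmorph0 mxE.
  have uM : M \in unitmx by rewrite unitmxE unitfE -normr_eq0 detM oner_eq0.
  have x00 : x = 0 by rewrite -[x](mulKmx uM) -/z z0 mulmx0.
  apply/eqP/matrixP=> i j; rewrite ord1 mxE; have /matrixP/(_ i 0) := x00.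
  by rewrite !mxE => /eqP; rewrite intr_eq0 => /eqP.
have N0 : \prod_i r i w != 0 by apply/prodf_neq0 => i _; rewrite fmorph_eq0.
have := norm_intr_ge1 (coset_norm_int wP) N0.
rewrite real_leNgt ?normr_real ?real1 //; case/negP.
rewrite normr_prod (bigD1 ord0) //= (le_lt_trans _ lt_z) //.
rewrite ler_piMr //.
suffices /andP[] : 0 <= \prod_(i | i != ord0) `|r i w| <= 1 by [].
apply: (big_ind (fun y : algC => 0 <= y <= 1)) => [|y y' /andP[y0 y1] /andP[y0' y1']|i _].
- by rewrite ler01 lexx.
- by rewrite mulr_ge0 ?mulr_ile1.
- by rewrite normr_ge0 le_z.
Qed.

End UnimodularBasis.

Theorem unramified_trivial (T : finType) (act : GQ -> T -> T) (x0 : T) (X : seq algC) :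
    (forall s t u : GQ, (forall x, u x = s (t x)) -> forall p, act u p = act s (act t p)) ->
    (forall s : GQ, {in X, s =1 id} -> forall p, act s p = p) ->
    (forall p P, prime p -> Defs.prime_above p P ->
       forall s : GQ, inertia P s -> act s x0 = x0) ->
  forall s, act s x0 = x0.
Proof.
move=> act_comp act_cont unram s.
have [n [r [pi [r0 rsurj r_inj piE]]]] := coset_reps x0 act_comp act_cont.
have n0 := unimodular_basis_trivial act_comp act_cont unram r_inj piE.
have [i ->] := rsurj s; suffices -> : i = ord0 by [].
by apply/val_inj; rewrite /= -[val i]/(i : nat); have := ltn_ord i; rewrite {2}n0; case: (i : nat).
Qed.

(** * Galois equivariance of the Weil pairing *)

Section Curve.
Variable C : curve.
Implicit Types (s t u : GQ) (P Q : point C) (D E : divisor C) (f : ratfunbar C).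

(** The action is determined by its values on constants and on Q(C), which generate Qbar(C). *)
Lemma galfun_comp s t u : (forall x, u x = s (t x)) ->
  forall z, galfun C u z = galfun C s (galfun C t z).
Proof.
move=> Du z; have [r ->] := curve_compositum z.
rewrite !rmorph_sum; apply: eq_bigr => a _.
by rewrite !rmorphM /= !galfun_ratfun !galfun_const Du.
Qed.

Lemma galfun_id s : s =1 id -> galfun C s =1 id.
Proof.
move=> Ds z; have [r ->] := curve_compositum z.
rewrite rmorph_sum; apply: eq_bigr => a _.
by rewrite rmorphM /= galfun_ratfun galfun_const Ds.
Qed.

Lemma galfunVK s f : galfun C s (galfun C (GQinv s) f) = f.
Proof.
by rewrite -(@galfun_comp _ _ (GQcomp s (GQinv s))) // galfun_id // => x /=; rewrite algC_invautK.
Qed.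

Lemma point_inj P Q : (forall f, ord P f = ord Q f) -> P = Q.
Proof.
case: P Q => [o p1 p2 p3 p4 p5] [o' q1 q2 q3 q4 q5] /= /funext Eo; case: _ / Eo q1 q2 q3 q4 q5 => *.
by congr Point; apply: Prop_irrelevance.
Qed.

Lemma gal_point_comp s t u : (forall x, u x = s (t x)) ->
  forall P, gal_point u P = gal_point s (gal_point t P).
Proof.
move=> Du P; apply: point_inj => f /=; congr (ord P _).
apply: (galfun_comp (s := GQinv t) (t := GQinv s)) => x.
by apply: (can_inj (algC_autK u)); rewrite algC_invautK Du /= !algC_invautK.
Qed.

Lemma gal_point_id s : s =1 id -> gal_point (C := C) s =1 id.
Proof.
move=> Ds P; apply: point_inj => f /=; rewrite galfun_id // => x.
by apply: (can_inj (algC_autK s)); rewrite algC_invautK Ds.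
Qed.

Lemma gal_pointK s : cancel (gal_point (C := C) s) (gal_point (GQinv s)).
Proof.
move=> P; rewrite -(@gal_point_comp _ _ (GQcomp (GQinv s) s)) // gal_point_id // => x.
by rewrite /= algC_autK.
Qed.

Lemma gal_pointVK s : cancel (gal_point (C := C) (GQinv s)) (gal_point s).
Proof.
move=> P; rewrite -(@gal_point_comp _ _ (GQcomp s (GQinv s))) // gal_point_id // => x.
by rewrite /= algC_invautK.
Qed.

Lemma ord_gal_pointV s P f : ord (gal_point (GQinv s) P) f = ord P (galfun C s f).
Proof.
rewrite /=; congr (ord P _); apply: (can_inj (galfunK (C := C) (GQinv s))).
rewrite -(@galfun_comp (GQinv s) s (GQcomp (GQinv s) s)) // galfunVK galfun_id // => x.
by rewrite /= algC_autK.
Qed.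

Lemma divisorP D E : (forall P, coeff P D = coeff P E) -> D = E.
Proof. by move=> DE; apply/eqP/freeg_eqP. Qed.

Lemma coeff_gal_div s Q D : coeff Q (gal_div s D) = coeff (gal_point (GQinv s) Q) D.
Proof.
rewrite -[in RHS](freeg_sumE D) /gal_div !raddf_sum; apply: eq_bigr => P _.
by rewrite /= !coeffU -(can2_eq (gal_pointK s) (gal_pointVK s)).
Qed.

Lemma gal_divB s D E : gal_div s (D - E) = gal_div s D - gal_div s E.
Proof. by apply: divisorP => P; rewrite coeffB !coeff_gal_div coeffB. Qed.

Lemma gal_divMn s D n : gal_div s (D *+ n) = gal_div s D *+ n.
Proof. by apply: divisorP => P; rewrite coeffMn !coeff_gal_div coeffMn. Qed.

Lemma deg_gal_div s D : deg (gal_div s D) = deg D.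
Proof.
rewrite -[in RHS](freeg_sumE D) /gal_div !raddf_sum; apply: eq_bigr => P _.
by rewrite /= !degU.
Qed.

Lemma mem_dom_gal_div s Q D : (Q \in dom (gal_div s D)) = (gal_point (GQinv s) Q \in dom D).
Proof. by rewrite !mem_dom coeff_gal_div. Qed.

Lemma is_div_gal s f D : is_div f D -> is_div (galfun C s f) (gal_div s D).
Proof.
move=> [f0 fD]; split=> [|P]; first by rewrite fmorph_eq0.
by rewrite coeff_gal_div fD ord_gal_pointV.
Qed.

Lemma is_div_inj f D E : is_div f D -> is_div f E -> D = E.
Proof. by move=> [_ fD] [_ fE]; apply: divisorP => P; rewrite fD fE. Qed.

Lemma cls_eq D E : cls D = cls E <-> exists f, is_div f (D - E).
Proof.
split=> [/eqP|[f fDE]].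
  rewrite /cls /Pic -Quotient.idealrBE => /asboolP //.
by apply/eqP; rewrite /cls /Pic -Quotient.idealrBE; apply/asboolP; exists f.
Qed.

Lemma gal_cls_cls s D : gal_cls s (cls D) = cls (gal_div s D).
Proof.
have : cls (generic_quotient.repr (cls D)) = cls D by rewrite /cls reprK.
move=> /cls_eq[f /(is_div_gal s)]; rewrite gal_divB => fP.
by apply/cls_eq; exists (galfun C s f).
Qed.

Lemma cls_repr (c : Pic C) : exists D, c = cls D.
Proof. by exists (generic_quotient.repr c); rewrite /cls reprK. Qed.

Lemma clsMn D n : cls (D *+ n) = cls D *+ n.
Proof. by rewrite /cls -[LHS]/(\pi_(Pic C)%qT _) raddfMn. Qed.

Lemma gal_cls_comp s t u : (forall x, u x = s (t x)) ->
  forall c, gal_cls u c = gal_cls s (gal_cls (C := C) t c).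
Proof.
move=> Du c; have [D ->] := cls_repr c; rewrite !gal_cls_cls; congr cls.
apply: divisorP => P; rewrite !coeff_gal_div; congr (coeff _ D).
apply: (gal_point_comp (s := GQinv t) (t := GQinv s)) => x.
by apply: (can_inj (algC_autK u)); rewrite algC_invautK Du /= !algC_invautK.
Qed.

(* If n D = div f and s fixes the finitely many constants occurring in f, *)
(* then n s(D) = n D, whence s(D) = D.                                    *)
Lemma gal_cls_torsion_fixed n (c : Pic C) : (0 < n)%N -> c *+ n = 0 ->
  exists X : seq algC, forall s, {in X, s =1 id} -> gal_cls s c = c.
Proof.
move=> n_gt0; have [D ->] := cls_repr c; rewrite -clsMn -[0](raddf0 (\pi_(Pic C)%qT)).
move=> /cls_eq[f]; rewrite subr0 => fD; have [r Dr] := curve_compositum f.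
exists [seq a.1 | a <- r] => s sX; rewrite gal_cls_cls; congr cls.
have sf : galfun C s f = f.
  rewrite Dr rmorph_sum; apply: eq_big_seq => a ar.
  by rewrite rmorphM /= galfun_ratfun galfun_const sX ?map_f.
have := is_div_gal s fD; rewrite sf => /(is_div_inj fD) eqD.
apply: divisorP => P; have /(congr1 (coeff P)) := eqD.
rewrite gal_divMn !coeffMn => /eqP.
by rewrite eqr_pMn2r // => /eqP.
Qed.

Lemma value_at_gal s f P a : value_at f P a ->
  value_at (galfun C s f) (gal_point s P) (s a).
Proof.
move=> [->|fP]; first by left; rewrite galfun_const.
by right; rewrite -galfun_const -rmorphB /= galfunK.
Qed.

Lemma prod_dom_gal s D (w : point C -> algC) :
  \prod_(P <- dom (gal_div s D)) w P ^ coeff P (gal_div s D) =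
  \prod_(P <- dom D) w (gal_point s P) ^ coeff P D.
Proof.
have s_inj := can_inj (gal_pointK s).
have domE : perm_eq (dom (gal_div s D)) [seq gal_point s P | P <- dom D].
  apply: uniq_perm; rewrite ?uniq_dom ?(map_inj_uniq s_inj) ?uniq_dom // => P.
  by rewrite mem_dom_gal_div -[P in RHS](gal_pointVK s) (mem_map s_inj).
rewrite (perm_big _ domE) big_map; apply: eq_bigr => P _.
by rewrite coeff_gal_div gal_pointK.
Qed.

Lemma value_div_gal s f E a : value_div f E a ->
  value_div (galfun C s f) (gal_div s E) (s a).
Proof.
move=> [w [wP ->]]; exists (fun P => s (w (gal_point (GQinv s) P))); split=> [P|].
  rewrite mem_dom_gal_div -{2}[P](gal_pointVK s) => /wP; exact: value_at_gal.
rewrite prod_dom_gal rmorph_prod; apply: eq_bigr => P _.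
by rewrite gal_pointK fmorphXz.
Qed.

(** All the witnesses are transported by s: divisors, functions, and values at points. *)
Lemma weil_pairing_gal l s (c d : Pic C) a : weil_pairing l c d a ->
  weil_pairing l (gal_cls s c) (gal_cls s d) (s a).
Proof.
move=> [D [E [f [h [u [w [[Dc Dd D0 E0] [[DE fD hE fu hw] Da]]]]]]]].
exists (gal_div s D), (gal_div s E), (galfun C s f), (galfun C s h), (s u), (s w).
rewrite Dc Dd !gal_cls_cls !deg_gal_div Da fmorph_div; split=> //; split=> //; split=> //.
- by move=> P; rewrite !mem_dom_gal_div.
- by rewrite -gal_divMn; apply: is_div_gal.
- by rewrite -gal_divMn; apply: is_div_gal.
- exact: value_div_gal.
- exact: value_div_gal.
Qed.

End Curve.

(** * Groups generated by symplectic transvections *)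

Section SympForm.
Variables (F : fieldType) (g : nat).
Hypothesis two_neq0 : 2%:R != 0 :> F.
Implicit Types (x y z v w : 'rV[F]_(g + g)) (a b c : F) (A B : 'M[F]_(g + g)).
Local Notation J := (symp_mx F g).
Local Notation om := (@symp_form F g).

Lemma symp_formE x y : x *m J *m y^T = (om x y)%:M.
Proof. by rewrite [LHS]mx11_scalar. Qed.

Lemma trmx_symp : J^T = - J.
Proof.
by rewrite /symp_mx tr_block_mx opp_block_mx !trmx0 raddfN /= trmx1 !oppr0 opprK.
Qed.

Lemma symp_mx_sqr : J *m J = - 1%:M.
Proof.
rewrite /symp_mx mulmx_block !mul0mx !mulmx0 !add0r !mulmx1 !mul1mx !addr0.
by rewrite [in RHS]scalar_mx_block opp_block_mx !oppr0.
Qed.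

Lemma symp_mx_unit : J \in unitmx.
Proof.
suffices : J *m (- J) = 1%:M by case/mulmx1_unit.
by rewrite mulmxN symp_mx_sqr opprK.
Qed.

Lemma symp_formDl x y z : om (x + y) z = om x z + om y z.
Proof. by rewrite /symp_form !mulmxDl mxE. Qed.
Lemma symp_formDr x y z : om z (x + y) = om z x + om z y.
Proof. by rewrite /symp_form raddfD mulmxDr mxE. Qed.
Lemma symp_formZl a x y : om (a *: x) y = a * om x y.
Proof. by rewrite /symp_form -!scalemxAl mxE. Qed.
Lemma symp_formZr a x y : om y (a *: x) = a * om y x.
Proof. by rewrite /symp_form linearZ -scalemxAr mxE. Qed.
Lemma symp_formNl x y : om (- x) y = - om x y.
Proof. by rewrite -scaleN1r symp_formZl mulN1r. Qed.
Lemma symp_formNr x y : om y (- x) = - om y x.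
Proof. by rewrite -scaleN1r symp_formZr mulN1r. Qed.
Lemma symp_form0l x : om 0 x = 0.
Proof. by rewrite -(scale0r 0) symp_formZl mul0r. Qed.

Lemma symp_formC x y : om x y = - om y x.
Proof.
have : (x *m J *m y^T)^T = - (y *m J *m x^T).
  by rewrite !trmx_mul trmxK trmx_symp mulNmx mulmxN mulmxA.
by rewrite !symp_formE tr_scalar_mx => /matrixP/(_ 0 0); rewrite !mxE eqxx !mulr1n.
Qed.

Lemma symp_formxx x : om x x = 0.
Proof.
apply/eqP; have /eqP := symp_formC x x; rewrite -addr_eq0 -mulr2n -mulr_natr mulf_eq0.
by rewrite (negPf two_neq0) orbF.
Qed.

Lemma symp_form_eq0C x y : (om x y == 0) = (om y x == 0).
Proof. by rewrite symp_formC oppr_eq0. Qed.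

Lemma symp_form_nondeg x : x != 0 -> exists y, om x y != 0.
Proof.
move=> x0; have /rV0Pn[j xJj] : x *m J != 0.
  by apply: contraNneq x0 => xJ; rewrite -[x](mulmxK symp_mx_unit) xJ mul0mx.
by exists (delta_mx 0 j); rewrite /symp_form trmx_delta -colE mxE.
Qed.

(** The map sending a row vector x to x + a <x, v> v. *)
Definition transv a v : 'M[F]_(g + g) := 1%:M + a *: (J *m v^T *m v).

Lemma mul_transv x a v : x *m transv a v = x + (a * om x v) *: v.
Proof.
rewrite mulmxDr mulmx1 -scalemxAr !mulmxA symp_formE mul_scalar_mx scalerA //.
Qed.

Lemma rowvecP A B : (forall x, x *m A = x *m B) -> A = B.
Proof. by move=> AB; apply/row_matrixP=> i; rewrite !rowE AB. Qed.

Lemma transvZ a b v : transv a (b *: v) = transv (a * b ^+ 2) v.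
Proof.
apply: rowvecP => x; rewrite !mul_transv symp_formZr scalerA; congr (_ + _ *: _); ring.
Qed.

Lemma transvM a b v : transv a v *m transv b v = transv (a + b) v.
Proof.
apply: rowvecP => x; rewrite mulmxA !mul_transv symp_formDl symp_formZl symp_formxx mulr0 addr0.
by rewrite mulrDl scalerDl addrA.
Qed.

Lemma transv0 v : transv 0 v = 1%:M.
Proof. by rewrite /transv scale0r addr0. Qed.

Definition simil c A := forall x y, om (x *m A) (y *m A) = c * om x y.

Lemma simil_transv a v : simil 1 (transv a v).
Proof.
move=> x y; rewrite !mul_transv !(symp_formDl, symp_formDr, symp_formZl, symp_formZr).
by rewrite symp_formxx (symp_formC v y); ring.
Qed.

Lemma simil_mx c A : A *m J *m A^T = c *: J <-> simil c A.
Proof.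
split=> [AJ x y|AJ].
  have : (x *m A) *m J *m (y *m A)^T = c *: (x *m J *m y^T).
    by rewrite trmx_mul !mulmxA -(mulmxA x A) -(mulmxA x (A *m J)) AJ -scalemxAr -scalemxAl.
  by rewrite !symp_formE => /matrixP/(_ 0 0); rewrite !mxE eqxx !mulr1n.
apply/matrixP=> i j; have := AJ (delta_mx 0 i) (delta_mx 0 j).
have omE B : (delta_mx 0 i *m B *m (delta_mx 0 j)^T : 'M[F]_1) 0 0 = B i j.
  by rewrite trmx_delta -rowE -colE !mxE.
rewrite /symp_form omE trmx_mul !mulmxA => E.
by rewrite [RHS]mxE -E -(omE (A *m J *m A^T)) !mulmxA.
Qed.

Lemma simil_unit c A : c != 0 -> simil c A -> A \in unitmx.
Proof.
move=> c0 /simil_mx AJ; suffices : A *m (J *m A^T *m (c^-1 *: - J)) = 1%:M by case/mulmx1_unit.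
by rewrite !mulmxA AJ -scalemxAl -scalemxAr scalerA mulfV // scale1r mulmxN symp_mx_sqr opprK.
Qed.

Lemma transvJ c A a v : A \in unitmx -> c != 0 -> simil c A ->
  transv a (v *m A) = invmx A *m transv (c * a) v *m A.
Proof.
move=> uA c0 AJ; apply: rowvecP => x; rewrite !mulmxA !mul_transv mulmxDl -scalemxAl mulmxKV //.
have := AJ (x *m invmx A) v; rewrite mulmxKV // => ->.
by congr (_ + _ *: _); ring.
Qed.

(* A unipotent transvection N = A - 1 = u w satisfies w u = 0, so that A fixes w *)
(* and its multiplier is 1.                                                      *)
Lemma transvection_transv c A : simil c A -> transvection A ->
  exists a v, [/\ a != 0, v != 0 & A = transv a v].
Proof.
move=> AJ [[m Nm] rk1]; set N := A - 1%:M in Nm rk1.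
have [u [w DN]] : exists (u : 'cV[F]_(g + g)) (w : 'rV[F]_(g + g)), N = u *m w.
  have : exists (u : 'M[F]_(g + g, \rank N)) (w : 'M[F]_(\rank N, g + g)), N = u *m w.
    by exists (col_base N), (row_base N); rewrite mulmx_base.
  by rewrite rk1.
have N0 : N != 0 by rewrite -mxrank_eq0 rk1.
have w0 : w != 0 by apply: contraNneq N0 => w0; rewrite DN w0 mulmx0.
pose al x : F := (x *m u) 0 0.
have mulN x : x *m N = al x *: w.
  by rewrite DN mulmxA [x *m u]mx11_scalar mul_scalar_mx.
have mulA x : x *m A = x + al x *: w.
  by rewrite -mulN /N mulmxBr mulmx1 addrC subrK.
have alw : al w = 0.
  apply/eqP; apply: contraNT w0 => alw0.
  have wN k : w *m N ^+ k = al w ^+ k *: w.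
    elim: k => [|k IHk]; first by rewrite !expr0 scale1r mulmx1.
    by rewrite !exprSr mulmxA IHk -scalemxAl mulN scalerA.
  have := wN m; rewrite Nm mulmx0 => /esym/eqP; rewrite scaler_eq0.
  by rewrite expf_eq0 (negPf alw0) andbF.
have [y wy] := symp_form_nondeg w0.
have c1 : c = 1.
  have := AJ w y; rewrite !mulA alw scale0r addr0 symp_formDr symp_formZr symp_formxx mulr0 addr0.
  by rewrite -{1}[om w y]mul1r => /(mulIf wy).
have alE x : al x = - al y / om w y * om x w.
  have := AJ x y; rewrite c1 mul1r !mulA !(symp_formDl, symp_formDr, symp_formZl, symp_formZr).
  rewrite symp_formxx !mulr0 addr0 -addrA -[RHS]addr0 => /addrI/eqP.
  rewrite addr_eq0 => /eqP xE; apply: (mulfI wy).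
  transitivity (- (al y * om x w)); first by rewrite xE opprK mulrC.
  by field.
exists (- al y / om w y), w; split=> //.
  apply: contraNneq N0 => a0; apply/eqP/rowvecP => x.
  by rewrite mulN alE a0 mul0r scale0r mulmx0.
by apply: rowvecP => x; rewrite mulA mul_transv -alE.
Qed.

End SympForm.

(** * Transvections generate the symplectic group *)

Section SpGen.
Variables (F : fieldType) (g : nat).
Hypothesis two_neq0 : 2%:R != 0 :> F.
Implicit Types (x y z v w : 'rV[F]_(g + g)) (a b c : F) (A B : 'M[F]_(g + g)).
Local Notation om := (@symp_form F g).
Local Notation transv := (@transv F g).

Lemma symp_form_nondeg2 x y : x != 0 -> y != 0 -> exists w, om x w != 0 /\ om y w != 0.
Proof.
move=> /symp_form_nondeg[u xu] /symp_form_nondeg[v yv].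
have [yu|] := eqVneq (om y u) 0; last by exists u.
have [xv|] := eqVneq (om x v) 0; last by exists v.
by exists (u + v); rewrite !symp_formDr yu xv addr0 add0r.
Qed.

(* If A moves x, at most two transvections with centers in the image of A - 1 *)
(* (which is orthogonal to the fixed space of A) carry x to x A.              *)
Lemma transv_generate (G : 'M[F]_(g + g) -> Prop) :
    (forall a v, G (transv a v)) -> (forall A B, G A -> G B -> G (A *m B)) ->
  forall A, simil 1 A -> G A.
Proof.
move=> Gtv GM A; move: {2}(\rank (A - 1%:M)) (leqnn (\rank (A - 1%:M))) => k.
elim: k A => [|k IHk] A leAk sA.
  suffices -> : A = transv 0 0 by [].
  by move: leAk; rewrite leqn0 mxrank_eq0 subr_eq0 transv0 => /eqP.
have [->|A1] := eqVneq A 1%:M; first by rewrite -(transv0 0).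
have [x xA] : exists x, x *m A != x.
  apply: contrapT => /forallNP fixA; move/eqP: A1; apply; apply: rowvecP => x.
  by rewrite mulmx1; apply/eqP/negPn/negP/fixA.
have uA : A \in unitmx by apply: simil_unit sA; rewrite oner_neq0.
(* The two conditions say that z = w (A - 1) is orthogonal neither to x nor to x A. *)
have [w [w1 w2]] : exists w, om (x *m invmx A - x) w != 0 /\ om (x - x *m A) w != 0.
  apply: symp_form_nondeg2; rewrite subr_eq0; last by rewrite eq_sym.
  by apply: contraNneq xA => {1}<-; rewrite mulmxKV.
pose z := w *m A - w.
have orthz y : y *m A = y -> om y z = 0.
  by move=> yA; rewrite symp_formDr symp_formNr -{1}yA sA mul1r subrr.
have xz : om x z != 0.
  apply: contraNneq w1; rewrite symp_formDr symp_formNr symp_formDl symp_formNl.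
  by rewrite -{1}[x](mulmxKV uA) sA mul1r => ->.
have xAz : om (x *m A) z != 0.
  apply: contraNneq w2; rewrite symp_formDr symp_formNr symp_formDl symp_formNl.
  by rewrite sA mul1r => ->.
(* A preliminary transvection along z (lam = 1) is used only when x is orthogonal to x A. Then x1 is
   not orthogonal to x A, and the transvection along x A - x1 with coefficient mu carries x1 to x
   A. *)
have [lam x1xA] : exists lam, om (x + (lam * om x z) *: z) (x *m A) != 0.
  have [x0|] := eqVneq (om x (x *m A)) 0; last by exists 0; rewrite mul0r scale0r addr0.
  exists 1; rewrite symp_formDl x0 add0r symp_formZl mul1r mulf_neq0 //.
  by rewrite symp_formC oppr_eq0.
set x1 := x + _ in x1xA; pose y2 := x *m A - x1.
have x1y2 : om x1 y2 = om x1 (x *m A).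
  by rewrite symp_formDr symp_formNr symp_formxx // oppr0 addr0.
have orthy y : y *m A = y -> om y y2 = 0.
  move=> yA; rewrite symp_formDr symp_formNr -{1}yA sA mul1r symp_formDr symp_formZr (orthz y) //.
  by rewrite mulr0 addr0 subrr.
pose mu := (om x1 y2)^-1.
(* B fixes x and everything that A fixes, so the rank of B - 1 is smaller. *)
pose B := A *m (transv (- mu) y2 *m transv (- lam) z).
have tvK a v : transv (- a) v *m transv a v = 1%:M by rewrite transvM // addNr transv0.
have DA : A = B *m (transv lam z *m transv mu y2).
  rewrite -!mulmxA; rewrite (mulmxA (transv (- lam) z)) tvK mul1mx tvK mulmx1 //.
rewrite DA; apply: (GM); last exact: GM.
apply: IHk.
  rewrite -ltnS; apply: leq_trans leAk.
  have xB : x *m B = x.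
    rewrite !mulmxA; have -> : x *m A = x *m transv lam z *m transv mu y2.
      rewrite !mul_transv // -/x1 mulVf ?x1y2 // scale1r /y2 addrC subrK //.
    rewrite -(mulmxA _ (transv mu y2)) transvM // subrr transv0 mulmx1.
    by rewrite -(mulmxA x) transvM // subrr transv0 mulmx1.
  have fixAB y : y *m A = y -> y *m B = y.
    move=> yA; rewrite mulmxA yA mulmxA !mul_transv // orthy // mulr0 scale0r addr0.
    by rewrite (orthz y) // mulr0 scale0r addr0.
  have kerE D y : (y <= kermx (D - 1%:M))%MS = (y *m D == y).
    by rewrite (sameP sub_kermxP eqP) mulmxBr mulmx1 subr_eq0.
  have /rank_ltmx : (kermx (A - 1%:M) < kermx (B - 1%:M))%MS.
    rewrite ltmxE; apply/andP; split.
      apply/row_subP => i; rewrite kerE; apply/eqP/fixAB/eqP.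
      by rewrite -kerE row_sub.
    apply: contra xA => /(submx_trans _) kerBA; rewrite -kerE; apply: kerBA.
    by rewrite kerE xB.
  by rewrite !mxrank_ker ltn_sub2lE // rank_leq_row.
have simM C D : simil 1 C -> simil 1 D -> simil 1 (C *m D).
  by move=> sC sD y y'; rewrite !mulmxA sD mul1r sC.
by apply: (simM) => //; apply: simM; apply: simil_transv.
Qed.

End SpGen.

(** * Centers of the transvections in an irreducible group *)

Section Centers.
Variables (F : finFieldType) (g : nat).
Hypothesis F_prime : forall a : F, exists n : nat, a = n%:R.
Hypothesis two_neq0 : 2%:R != 0 :> F.
Variable G : 'M[F]_(g + g) -> Prop.
Implicit Types (x y z v w : 'rV[F]_(g + g)) (a b c : F) (A B : 'M[F]_(g + g)).
Local Notation om := (@symp_form F g).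
Local Notation transv := (@transv F g).

Hypothesis GM : forall A B, G A -> G B -> G (A *m B).
Hypothesis GV : forall A, G A -> G (invmx A).
Hypothesis G_simil : forall A, G A -> exists2 c, c != 0 & simil c A.
Hypothesis G_irr : forall U : 'M[F]_(g + g),
  (forall A, G A -> stablemx U A) -> U = 0 \/ row_full U.
Hypothesis G_transv : exists2 A, G A & transvection A.
Hypothesis G_dec : forall m (V : 'I_m -> 'M[F]_(g + g)),
  [/\ mxdirect (\sum_i V i)%MS, row_full (\sum_i V i)%MS,
      (forall i, nondegenerate_on (V i)) &
      (forall A, G A -> forall i, exists j, (V i *m A == V j)%MS)] ->
  forall A, G A -> forall i, (V i *m A == V i)%MS.

Let G_unit A : G A -> A \in unitmx.
Proof. by move=> /G_simil[c c0 /simil_unit]; apply. Qed.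

Definition center v := `[< forall a, G (transv a v) >].

Lemma center_transv v a : center v -> G (transv a v).
Proof. by move/asboolP. Qed.

Lemma centerZ b v : center v -> center (b *: v).
Proof. by move=> /asboolP vP; apply/asboolP => a; rewrite transvZ. Qed.

Lemma center_mul v A : G A -> center v -> center (v *m A).
Proof.
move=> GA /asboolP vP; apply/asboolP => a; have [c c0 sA] := G_simil GA.
by rewrite (transvJ a v (G_unit GA) c0 sA); apply: (GM) => //; apply: (GM) => //; apply: GV.
Qed.

Lemma center0 : center 0.
Proof.
apply/asboolP => a; have [A GA _] := G_transv.
by rewrite /transv mulmx0 scaler0 addr0 -(mulmxV (G_unit GA)); apply: GM => //; apply: GV.
Qed.

(** Powers of one transvection give all its multiples, the field being prime. *)
Lemma center_of_transv a v : a != 0 -> G (transv a v) -> center v.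
Proof.
move=> a0 Gav; have Gn n : G (transv (n.+1%:R * a) v).
  elim: n => [|n IHn]; first by rewrite mul1r.
  by rewrite -natr1 mulrDl mul1r -transvM //; apply: GM.
apply/asboolP => b; have [n Dn] := F_prime (b / a - 1).
by have := Gn n; rewrite -natr1 -Dn subrK mulfVK.
Qed.

(** v + b w is the image of v under a transvection with center w. *)
Lemma center_add1 v w b : center v -> center w -> om v w != 0 -> center (v + b *: w).
Proof.
move=> Cv Cw vw; have := center_mul (center_transv (b / om v w) Cw) Cv.
by rewrite mul_transv mulfVK.
Qed.

Lemma center_exists : exists2 v, center v & v != 0.
Proof.
have [A GA tA] := G_transv; have [c c0 sA] := G_simil GA.
have [a [v [a0 v0 DA]]] := transvection_transv two_neq0 sA tA.
by exists v => //; apply: (center_of_transv a0); rewrite -DA.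
Qed.

Definition span_centers (P : pred 'rV[F]_(g + g)) : 'M[F]_(g + g) := (\sum_(v | P v) <<v>>)%MS.

Lemma span_centersP (P : pred _) v : P v -> (v <= span_centers P)%MS.
Proof. by move=> Pv; apply: (sumsmx_sup v); rewrite ?genmxE. Qed.

Lemma span_centers_sub (P : pred _) n (U : 'M[F]_(n, g + g)) :
  (forall v, P v -> (v <= U)%MS) -> (span_centers P <= U)%MS.
Proof. by move=> PU; apply/sumsmx_subP => v /PU; rewrite genmxE. Qed.

Lemma orth_kerE x y : (x <= kermx (symp_mx F g *m y^T))%MS = (om x y == 0).
Proof.
rewrite (sameP sub_kermxP eqP) mulmxA symp_formE; apply/eqP/eqP => [|->].
  by move=> /matrixP/(_ 0 0); rewrite !mxE eqxx mulr1n.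
by rewrite raddf0.
Qed.

Lemma span_centers_orth (P : pred _) y : (forall v, P v -> om v y = 0) ->
  forall x, (x <= span_centers P)%MS -> om x y = 0.
Proof.
move=> Py x Px; apply/eqP; rewrite -orth_kerE (submx_trans Px) //.
by apply: span_centers_sub => v /Py vy; rewrite orth_kerE vy.
Qed.

Lemma genmxM_sub v A n (U : 'M[F]_(n, g + g)) :
  (v *m A <= U)%MS -> (<<v>>%MS *m A <= U)%MS.
Proof. by apply: submx_trans; rewrite submxMr ?genmxE. Qed.

Lemma row_full_span_centers : row_full (span_centers center).
Proof.
have [|U0|//] := @G_irr (span_centers center).
  move=> A GA; rewrite /span_centers sumsmxMr; apply/sumsmx_subP => v Cv.
  exact/genmxM_sub/span_centersP/center_mul.
have [v Cv v0] := center_exists; have := span_centersP Cv; rewrite U0 submx0.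
by rewrite (negPf v0).
Qed.

Lemma center_nondeg z : z != 0 -> exists2 y, center y & om z y != 0.
Proof.
move=> z0; apply: contrapT => nz; have [y zy] := symp_form_nondeg z0.
case/eqP: zy; rewrite symp_formC; apply/eqP; rewrite oppr_eq0; apply/eqP.
apply: (@span_centers_orth center); last by apply: submx_full row_full_span_centers.
move=> v Cv; apply/eqP; rewrite symp_form_eq0C; apply/negPn/negP => zv.
by apply: nz; exists v.
Qed.

Definition center_rel := [rel v w | [&& center v, center w & om v w != 0]].

Lemma center_rel_sym : connect_sym center_rel.
Proof. by apply: sym_connect_sym => v w /=; rewrite symp_form_eq0C andbCA. Qed.

Lemma connect_center v w : connect center_rel v w -> center v -> center w.
Proof.
move=> /connectP[p]; elim: p v => [v _ ->//|u p IHp v /= /andP[/and3P[_ Cu _]] up Dw _].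
exact: IHp Dw Cu.
Qed.

Lemma connect_mul A v w : G A -> connect center_rel v w -> connect center_rel (v *m A) (w *m A).
Proof.
move=> GA; have [c c0 sA] := G_simil GA.
move=> /connectP[p]; elim: p v => [v _ ->//|u p IHp v /= /andP[/and3P[Cv Cu vu]] up Dw].
apply: connect_trans (IHp _ up Dw); apply: connect1 => /=.
by rewrite !center_mul //= sA mulf_neq0.
Qed.

(** Spans of distinct components are orthogonal and together fill the space, so they form a
    symplectic decomposition, which G permutes. By [G_dec] each span is G-stable, hence the whole
    space, and two whole spaces cannot be orthogonal. *)
Lemma center_connected v w : center v -> center w -> v != 0 -> w != 0 -> connect center_rel v w.
Proof.
pose R := [set v | [&& center v, v != 0 & fingraph.root center_rel v == v]].
pose comp r := [pred v | connect center_rel r v].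
pose e (i : 'I_#|R|) : 'rV[F]_(g + g) := enum_val i.
have [V VE] : exists V : 'I_#|R| -> 'M[F]_(g + g), forall i, V i = span_centers (comp (e i)).
  by exists (fun i => span_centers (comp (e i))).
have RP i : [/\ center (e i), e i != 0 & fingraph.root center_rel (e i) = e i].
  by have := @enum_valP _ (mem R) i; rewrite inE => /and3P[? ? /eqP].
have compC i u : comp (e i) u -> center u.
  by move=> /connect_center; apply; case: (RP i).
have comp_orth i j u u' : i != j -> comp (e i) u -> comp (e j) u' -> om u u' = 0.
  move=> neqij iu ju'; apply/eqP/negPn/negP => uu'; case/eqP: neqij.
  have uu1 : connect center_rel u u' by apply: connect1; rewrite /= uu' (compC _ _ iu) (compC _ _ ju').
  have /(fingraph.rootP center_rel_sym) : connect center_rel (e i) (e j).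
    by rewrite (connect_trans iu) // (connect_trans uu1) // center_rel_sym.
  by case: (RP i) => _ _ ->; case: (RP j) => _ _ -> /enum_val_inj.
have inR u : center u -> u != 0 -> exists i, comp (e i) u.
  move=> Cu u0; have ur : connect center_rel u (fingraph.root center_rel u) by apply: connect_root.
  have rR : fingraph.root center_rel u \in R.
    rewrite inE (connect_center ur Cu) (fingraph.root_root center_rel_sym) ?eqxx ?andbT.
    have /connectP[[|u' p] /=] : connect center_rel (fingraph.root center_rel u) u by rewrite center_rel_sym.
      by move=> _ <-.
    move=> /andP[/and3P[_ _ ru] _] _; apply: contraNneq ru => ->; by rewrite symp_form0l.
  by exists (enum_rank_in rR (fingraph.root center_rel u)); rewrite /e enum_rankK_in //= center_rel_sym.
have V_orth i j x y : i != j -> (x <= V i)%MS -> (y <= V j)%MS -> om x y = 0.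
  rewrite !VE => neqij Vx Vy; apply: (span_centers_orth _ Vx) => u iu.
  rewrite symp_formC; apply/eqP; rewrite oppr_eq0; apply/eqP.
  apply: (span_centers_orth _ Vy) => u' ju'.
  by rewrite (comp_orth j i) // eq_sym.
have V_full : row_full (\sum_i V i)%MS.
  rewrite -sub1mx (submx_trans (_ : _ <= span_centers center)%MS) //.
    by rewrite sub1mx row_full_span_centers.
  apply: span_centers_sub => u Cu; have [->|u0] := eqVneq u 0; first exact: sub0mx.
  have [i iu] := inR u Cu u0; apply: (sumsmx_sup i) => //; rewrite VE; exact: span_centersP.
have V_nondeg i : nondegenerate_on (V i).
  move=> x Vx xP; apply/eqP/negPn/negP => /symp_form_nondeg[y]; case/negP.
  rewrite symp_form_eq0C -orth_kerE; apply: (submx_trans (submx_full _ V_full)).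
  apply/sumsmx_subP => j _; apply/row_subP => k; rewrite orth_kerE symp_form_eq0C.
  have [<-|neqij] := eqVneq i j; first by rewrite xP ?row_sub.
  by rewrite (V_orth i j) ?row_sub.
have V_direct : mxdirect (\sum_i V i)%MS.
  apply/mxdirect_sumsP => i _; apply/eqP/rowV0P => x; rewrite sub_capmx => /andP[Vx sumx].
  apply: (V_nondeg i) => // y Vy; apply/eqP; rewrite -orth_kerE.
  apply: (submx_trans sumx); apply/sumsmx_subP => j neqji.
  by apply/row_subP => k; rewrite orth_kerE (V_orth j i) ?row_sub.
have V_mul A i j v0 : G A -> comp (e i) v0 -> comp (e j) (v0 *m A) ->
    (V i *m A <= V j)%MS.
  move=> GA iv jvA; rewrite !VE /span_centers sumsmxMr; apply/sumsmx_subP => u iu.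
  apply/genmxM_sub/span_centersP; apply: connect_trans jvA _.
  by apply: connect_mul => //; rewrite (connect_trans _ iu) // center_rel_sym.
have V_perm A : G A -> forall i, exists j, (V i *m A == V j)%MS.
  move=> GA i; have [Cr r0 _] := RP i; set r := e i in Cr r0.
  have rA0 : r *m A != 0.
    by apply: contraNneq r0 => rA; rewrite -[r](mulmxK (G_unit GA)) rA mul0mx.
  have [j jrA] := inR _ (center_mul GA Cr) rA0; exists j.
  have rr : comp (e i) r by apply: connect0.
  apply/andP; split; first exact: (V_mul A i j r).
  rewrite -[V j](mulmxKV (G_unit GA)) submxMr //.
  by apply: (V_mul _ j i (r *m A)) => //; rewrite ?mulmxK ?G_unit //; exact: GV.
have V_fix := G_dec (And4 V_direct V_full V_nondeg V_perm).
have V_not0 i : V i != 0.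
  have [Cr r0 _] := RP i; apply: contraNneq r0 => Vi0.
  by rewrite -submx0 -Vi0 VE; apply: span_centersP; apply: connect0.
have V_all i : row_full (V i).
  have [A GA|Vi0|//] := @G_irr (V i).
    by have /andP[] := V_fix A GA i.
  by have := V_not0 i; rewrite Vi0 eqxx.
move=> Cv Cw v0 w0; have [i iv] := inR v Cv v0; have [j jw] := inR w Cw w0.
have [eqij|neqij] := eqVneq i j.
  by rewrite (connect_trans _ jw) // -eqij center_rel_sym.
have [y vy] := symp_form_nondeg v0; case/negP: vy; apply/eqP.
by apply: (V_orth i j) => //; rewrite submx_full.
Qed.

Definition linked v w : Prop := om v w != 0 \/ exists2 u, center u & om v u != 0 /\ om u w != 0.

(** Paths shorten to length at most 2: in v - t - u - w with v orthogonal to u and t to w, the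
    center t + u replaces both t and u. *)
Lemma center_linked v w : center v -> center w -> v != 0 -> w != 0 -> linked v w.
Proof.
move=> Cv Cw v0 w0; have /connectP[p] := center_connected Cv Cw v0 w0.
elim/last_ind: p w Cw w0 => [|p w' IHp] w Cw w0 /=.
  move=> _ Dw; have [y Cy vy] := center_nondeg v0.
  by right; exists y => //; split=> //; rewrite Dw symp_form_eq0C.
rewrite rcons_path last_rcons => /andP[vp /and3P[Cu _ uw]] Dw; rewrite -{}Dw in uw *.
set u := last v p in Cu uw *.
have u0 : u != 0 by apply: contraNneq uw => ->; rewrite symp_form0l.
have [vu|[t Ct [vt tu]]] := IHp u Cu u0 vp erefl; first by right; exists u.
have [vu|vu] := eqVneq (om v u) 0; last by right; exists u.
have [tw|tw] := eqVneq (om t w) 0; last by right; exists t.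
right; exists (t + 1 *: u); first exact: center_add1.
by rewrite scale1r symp_formDr vu addr0 symp_formDl tw add0r.
Qed.

Lemma center_addB v w : center v -> center w -> om v w != 0 -> center (v + w).
Proof. by move=> Cv Cw vw; rewrite -[w]scale1r; apply: center_add1. Qed.

(** Reach u + v + w through successive non-orthogonal sums, then subtract v. *)
Lemma center_add_via u w v : center u -> center w -> center v ->
  om u v != 0 -> om v w != 0 -> om u w = 0 -> om (u + w) v != 0 -> center (u + w).
Proof.
move=> Cu Cw Cv uv vw uw uwv.
have C1 : center (u + v + w).
  have uvw : om (u + v) w != 0 by rewrite symp_formDl uw add0r.
  exact: center_addB (center_addB Cu Cv uv) Cw uvw.
have -> : u + w = (u + v + w) + (-1) *: v by rewrite scaleN1r addrAC addrK.
apply: (center_add1 _ C1 Cv).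
suffices -> : om (u + v + w) v = om (u + w) v by [].
by rewrite !symp_formDl symp_formxx // addr0.
Qed.

(* If u + w is orthogonal to v, replace v by a center that is not orthogonal to u + w. *)
Lemma center_add_orth u w v y : center u -> center w -> center v -> center y ->
  om u v != 0 -> om v w != 0 -> om u w = 0 -> om (u + w) v = 0 ->
  om u y != 0 -> om w y = 0 -> center (u + w).
Proof.
move=> Cu Cw Cv Cy uv vw uw uwv uy wy.
have [v' [Cv' uv' vw' uwv' yv']] : exists v', [/\ center v', om u v' != 0, om v' w != 0,
    om (u + w) v' = 0 & om y v' != 0].
  have [yv|yv] := eqVneq (om y v) 0; last by exists v; split.
  exists (u + v); split.
  - exact: center_addB.
  - by rewrite symp_formDr symp_formxx // add0r.
  - by rewrite symp_formDl uw add0r.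
  - by rewrite symp_formDr uwv addr0 symp_formDl symp_formxx // add0r symp_formC uw oppr0.
  - by rewrite symp_formDr yv addr0 symp_form_eq0C.
have uwy : om (u + w) y != 0 by rewrite symp_formDl wy addr0.
(* One of c = 1 and c = -1 works: if c = 1 fails, then c = -1 gives -2 <u, v'>, which is nonzero as
   2 is invertible. *)
have [c [c0 uyc]] : exists c, c != 0 /\ om u (y + c *: v') != 0.
  have [E|E] := eqVneq (om u (y + 1 *: v')) 0; last by exists 1; rewrite oner_neq0.
  exists (-1); rewrite oppr_eq0 oner_neq0; split=> //.
  move: E; rewrite !symp_formDr !symp_formZr mul1r => /eqP; rewrite addr_eq0 => /eqP E.
  by rewrite E mulN1r -opprD oppr_eq0 -mulr2n -mulr_natl mulf_neq0.
apply: (@center_add_via u w (y + c *: v')) => //.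
- exact: center_add1.
- rewrite symp_formDl symp_formZl (symp_formC y) wy oppr0 add0r mulf_neq0 //.
- by rewrite symp_formDr symp_formZr uwv' mulr0 addr0.
Qed.

Lemma center_add u w : center u -> center w -> center (u + w).
Proof.
move=> Cu Cw; have [->|u0] := eqVneq u 0; first by rewrite add0r.
have [->|w0] := eqVneq w 0; first by rewrite addr0.
have [uw|uw] := eqVneq (om u w) 0; last exact: center_addB.
have [|[v Cv [uv vw]]] := center_linked Cu Cw u0 w0; first by rewrite uw eqxx.
have [->|z0] := eqVneq (u + w) 0; first exact: center0.
have [uwv|] := eqVneq (om (u + w) v) 0; last exact: center_add_via.
have [y Cy zy] := center_nondeg z0.
have [uy|uy] := eqVneq (om u y) 0; last first.
  have [wy|wy] := eqVneq (om w y) 0; first exact: (center_add_orth (v := v) (y := y)).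
  by apply: (center_add_via (v := y)) => //; rewrite symp_form_eq0C.
have wy : om w y != 0 by move: zy; rewrite symp_formDl uy add0r.
rewrite addrC; apply: (center_add_orth (v := v) (y := y)) => //.
- by rewrite symp_form_eq0C.
- by rewrite symp_form_eq0C.
- by rewrite symp_formC uw oppr0.
- by rewrite addrC.
Qed.

Lemma all_transv a v : G (transv a v).
Proof.
apply: center_transv; have /sub_sumsmxP[u ->] : (v <= span_centers center)%MS.
  exact: submx_full row_full_span_centers.
apply: (big_ind center) => [||w Cw]; [exact: center0|exact: center_add|].
have /submxP[c ->] : (u w *m <<w>>%MS <= w)%MS by rewrite (submx_trans (submxMl _ _)) ?genmxE.
by rewrite [c]mx11_scalar mul_scalar_mx; apply: centerZ.
Qed.

End Centers.

(** * The representation on the l-torsion *)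

Section Representation.
Variables (l : nat) (l_prime : prime l) (C : curve) (g : nat) (zeta : algC).
Variable phi : {additive 'rV['F_l]_(g + g) -> Pic C}.
Hypothesis phi_basis : symplectic_basis zeta phi.
Variable rho : GQ -> 'M['F_l]_(g + g).
Hypothesis rho_action : matrix_action phi rho.
Local Notation om := (@symp_form 'F_l g).

Let phi_inj : injective phi := symplectic_basis_inj phi_basis.
Let zeta_prim : l.-primitive_root zeta := symplectic_basis_root phi_basis.

(** The order is reversed because matrices act on row vectors from the right. *)
Lemma rho_comp (s t u : GQ) : (forall x, u x = s (t x)) -> rho u = rho t *m rho s.
Proof.
move=> Du; apply: rowvecP => v; apply: phi_inj.
by rewrite rho_action mulmxA !rho_action; apply: gal_cls_comp.
Qed.

Lemma rho_cont : exists X : seq algC, forall s : GQ, {in X, s =1 id} -> rho s = 1%:M.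
Proof.
have torsion v : phi v *+ l = 0.
  by rewrite -raddfMn -scaler_nat (pchar_Fp_0 l_prime) scale0r raddf0.
have fixed (i : 'I_(g + g)) : exists X : seq algC, forall s : GQ, {in X, s =1 id} ->
    gal_cls s (phi (delta_mx 0 i)) = phi (delta_mx 0 i).
  exact: gal_cls_torsion_fixed (prime_gt0 l_prime) (torsion _).
have [X XP] := boolp.choice fixed.
exists (flatten [seq X i | i <- enum 'I_(g + g)]) => s sX.
apply/row_matrixP => i; rewrite !rowE mulmx1; apply: phi_inj; rewrite rho_action.
by apply: XP => x xX; apply: sX; apply/flatten_mapP; exists i; rewrite ?mem_enum.
Qed.

Lemma rho1 (s : GQ) : s =1 id -> rho s = 1%:M.
Proof. by have [X XP] := rho_cont => Ds; apply: XP => x _; apply: Ds. Qed.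

Lemma rhoV (s : GQ) : rho s *m rho (GQinv s) = 1%:M.
Proof.
rewrite -(@rho_comp (GQinv s) s (GQcomp (GQinv s) s)) // rho1 // => x.
by rewrite /= algC_autK.
Qed.

Lemma rho_invmx (s : GQ) : invmx (rho s) = rho (GQinv s).
Proof.
have [us _] := mulmx1_unit (rhoV s).
by rewrite -[RHS](mulKmx us) rhoV mulmx1.
Qed.

Lemma Fl_eq_mod (i j : nat) : i = j %[mod l] -> i%:R = j%:R :> 'F_l.
Proof. by move=> eqij; rewrite -(Fp_nat_mod l_prime i) eqij Fp_nat_mod. Qed.

(** Apply s to the Weil pairing value zeta^<x, y> and compare exponents modulo l. *)
Lemma rho_simil (s : GQ) (k : nat) : s zeta = zeta ^+ k -> simil k%:R (rho s).
Proof.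
move=> sz x y; have := weil_pairing_gal s ((symplectic_basis_weil phi_basis x y _).2 erefl).
rewrite -!rho_action => /(symplectic_basis_weil phi_basis).
rewrite rmorphXn sz -exprM => /eqP; rewrite (eq_prim_root_expr zeta_prim) => /eqP E.
by rewrite -[LHS]natr_Zp -[om x y in RHS]natr_Zp -natrM; apply/esym/Fl_eq_mod.
Qed.

Lemma rho_multiplier (s : GQ) : exists2 c, c != 0 & simil c (rho s).
Proof.
have [k sz] : exists k, s zeta = zeta ^+ k.
  have [|i ->] := prim_rootP zeta_prim (_ : s zeta ^+ l = 1); last by exists i.
  by rewrite -rmorphXn (prim_expr_order zeta_prim) rmorph1.
exists k%:R; last exact: rho_simil sz.
rewrite -(dvdn_pcharf (pchar_Fp l_prime)); apply/negP => /dvdnP[m Dk].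
have : s zeta = s 1 by rewrite sz Dk mulnC exprM (prim_expr_order zeta_prim) expr1n rmorph1.
move=> /fmorph_inj z1; have := prim_order_dvd zeta_prim 1.
by rewrite z1 expr1n eqxx dvdn1 => /eqP l1; have := prime_gt1 l_prime; rewrite l1.
Qed.

Lemma rho_decomposition m (V : 'I_m -> 'M['F_l]_(g + g)) : quasi_unramified rho ->
  stable_symplectic_decomposition rho V -> forall s i, (V i *m rho s == V i)%MS.
Proof.
move=> unram Vdec s i.
(* G_Q acts on the finite set of all subsets of the space; the point x0 is the summand V i viewed as
   a set. *)
pose act (s : GQ) (A : {set 'rV['F_l]_(g + g)}) : {set 'rV['F_l]_(g + g)} := [set v *m rho s | v in A].
pose x0 := [set v : 'rV['F_l]_(g + g) | (v <= V i)%MS].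
have act_stab (t : GQ) : (V i *m rho t == V i)%MS -> act t x0 = x0.
  move=> /andP[sVt sVi]; have [ut _] := mulmx1_unit (rhoV t).
  apply/setP => v; apply/imsetP/idP => [[u]|]; rewrite !inE.
    by move=> uV ->; rewrite (submx_trans (submxMr _ uV)).
  move=> vV; exists (v *m invmx (rho t)); last by rewrite mulmxKV.
  rewrite inE -[V i](mulmxK ut) submxMr // (submx_trans vV) //.
have [X XP] := rho_cont.
have fix_x0 : act s x0 = x0.
  apply: (@unramified_trivial _ act x0 X) => [t u t' Dt' A|t tX A|p P prp Pp t inert].
  - rewrite /act (rho_comp Dt'); apply/setP => v; apply/imsetP/imsetP.
      move=> [w wA ->]; exists (w *m rho u); last by rewrite mulmxA.
      by apply/imsetP; exists w.
    by move=> [_ /imsetP[w wA ->] ->]; exists w; rewrite ?mulmxA.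
  - by rewrite /act (XP t tX); apply/setP=> v; apply/imsetP/idP => [[w wA ->]|vA];
      [rewrite mulmx1|exists v; rewrite ?mulmx1].
  - exact/act_stab/(unram _ _ Vdec _ _ prp Pp).
have sVi (v : 'rV_(g + g)) : (v <= V i)%MS -> (v *m rho s <= V i)%MS.
  move=> vV; have : v *m rho s \in act s x0 by apply: imset_f; rewrite inE.
  by rewrite fix_x0 inE.
have sub : (V i *m rho s <= V i)%MS.
  by apply/row_subP => j; rewrite row_mul sVi // row_sub.
have [us _] := mulmx1_unit (rhoV s).
by rewrite -(mxrank_leqif_eq sub) mxrankMfree // row_free_unit.
Qed.

Lemma image_GSp : (2 < l)%N -> irreducible_rep rho -> quasi_unramified rho ->
  (exists s : GQ, transvection (rho s)) -> image_is_GSp rho.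
Proof.
move=> l_gt2 [g_gt0 irr] unram [s0 tv_s0].
have two_neq0 : 2%:R != 0 :> 'F_l.
  by rewrite -(dvdn_pcharf (pchar_Fp l_prime)) gtnNdvd.
pose G (A : 'M['F_l]_(g + g)) := exists s, rho s = A.
have GM A B : G A -> G B -> G (A *m B).
  by move=> [s <-] [t <-]; exists (GQcomp t s); apply: rho_comp.
have GV A : G A -> G (invmx A) by move=> [s <-]; exists (GQinv s); rewrite rho_invmx.
have Gall_tv : forall a v, G (transv a v).
  have F_prime (a : 'F_l) : exists n : nat, a = n%:R by exists (val a); rewrite natr_Zp.
  apply: (all_transv F_prime two_neq0 GM GV).
  - by move=> _ [s <-]; apply: rho_multiplier.
  - by move=> U UG; apply: irr => s; apply: UG; exists s.
  - by exists (rho s0) => //; exists s0.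
  - move=> m V [Vdir Vfull Vnd Vperm] _ [s <-] i.
    apply: rho_decomposition => //; split=> // t j.
    by apply: Vperm; exists t.
move=> A; split=> [[c c0 /simil_mx Ac]|[s <-]]; last first.
  by have [c c0 sc] := rho_multiplier s; exists c => //; apply/simil_mx.
have co_cl : coprime c l.
  rewrite coprime_sym prime_coprime // (dvdn_pcharf (pchar_Fp l_prime)).
  by rewrite natr_Zp.
(* An automorphism raising zeta to the power c has multiplier c, so dividing A by its matrix leaves
   a symplectic matrix. *)
have [u uP] := Qn_aut_exists co_cl.
have sim_u : simil c (rho u).
  have := @rho_simil u c; rewrite natr_Zp; apply.
  by apply: uP; rewrite (prim_expr_order zeta_prim).
have [uu _] := mulmx1_unit (rhoV u).
have [s Ds] : G (A *m invmx (rho u)).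
  apply: (transv_generate two_neq0 Gall_tv GM) => x y.
  by apply: (mulfI c0); rewrite mul1r -sim_u !mulmxA !mulmxKV.
by exists (GQcomp u s); rewrite (@rho_comp u s) // Ds mulmxKV.
Qed.

End Representation.

Theorem theorem5p6 (l : nat) (l_prime : prime l)
    (C : curve) (g : nat) (C_genus : genus C g)
    (zeta : algC) (phi : {additive 'rV['F_l]_(g + g) -> Pic C})
    (phi_basis : symplectic_basis zeta phi)
    (rho : GQ -> 'M['F_l]_(g + g)) (rho_action : matrix_action phi rho) :
  ((5 <= l)%N ->
     irreducible_rep rho -> quasi_unramified rho ->
     (exists s : GQ, transvection (rho s)) ->
     image_is_GSp rho) /\
  (l = 3%N ->
     irreducible_rep rho -> quasi_unramified rho ->
     (exists s : GQ, transvection (rho s)) ->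
     absolutely_irreducible rho -> strongly_quasi_unramified rho ->
     image_is_GSp rho).
Proof.
split=> [l_ge5 irr unram ex_tv|l3 irr unram ex_tv _ _];
  apply: (image_GSp l_prime phi_basis rho_action) => //.
  exact: leq_trans l_ge5.
by rewrite l3.
Qed.
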